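(* Let $B\subset A$ be a regular abelian $C^*$-subalgebra inclusion with the extension property, and let $\mathbb{E}:A\to B$ be its associated conditional expectation. Then the map $$S^{\mathrm{inv}}(B)\ni\phi\longmapsto\phi\circ\mathbb{E}\in T(A)$$ is an affine $w^*$-homeomorphism, with inverse $\tau\mapsto\tau|_B$.
   Context: A $C^*$-subalgebra $B\subset A$ is non-degenerate if $B$ contains an approximate unit for $A$. An element $n\in A$ normalizes $B$ if $nBn^*\cup n^*Bn\subset B$; $N(B)$ is the set of such elements. The inclusion is regular if $N(B)$ generates $A$ as a $C^*$-algebra. A non-degenerate abelian $C^*$-subalgebra inclusion $B\subset A$ has the extension property if every pure state on $B$ has a unique extension to a state on $A$; under this property there is a unique conditional expectation $\mathbb{E}:A\to B$, called the associated conditional expectation. A state $\phi$ on $B$ is fully invariant if $\phi(nbn^* )=\phi(n^*nb)$ for all $n\in N(B)$ and $b\in B$; $S^{\mathrm{inv}}(B)$ is the set of fully invariant states on $B$. $T(A)$ is the set of tracial states on $A$, i.e. states $\tau$ with $\tau(xy)=\tau(yx)$ for all $x,y\in A$. Both sets carry the weak-$*$ topology ($w^*$). *)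

(* Defs.v *)
From HB Require Import structures.
From mathcomp Require Import all_boot all_order all_algebra.
From mathcomp Require Import all_classical all_reals.
From mathcomp Require Import topology normedtype.
From mathcomp Require Import complex.
Set Implicit Arguments.
Unset Strict Implicit.
Unset Printing Implicit Defensive.

Import Order.TTheory GRing.Theory Num.Theory.
Import numFieldNormedType.Exports.
Local Open Scope classical_set_scope.
Local Open Scope ring_scope.
Local Open Scope complex_scope.

(* C*-algebras are not assumed unital, so the product cannot come from the
   (unital) ring structures; norms take values in R[i], as for every
   normedModType over R[i]. *)
HB.mixin Record isCStarAlg (R : realType) (A : Type)
    & CompleteNormedModule R[i] A := {
  cmul : A -> A -> A;
  star : A -> A;
  cmulA : associative cmul;
  cmulDl : left_distributive cmul +%R;
  cmulDr : right_distributive cmul +%R;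
  cmulZl : forall (k : R[i]) x y, cmul (k *: x) y = k *: cmul x y;
  cmulZr : forall (k : R[i]) x y, cmul x (k *: y) = k *: cmul x y;
  starK : involutive star;
  starD : {morph star : x y / x + y};
  starZ : forall (k : R[i]) x, star (k *: x) = k^* *: star x;
  starM : forall x y, star (cmul x y) = cmul (star y) (star x);
  cnormM : forall x y, `|cmul x y| <= `|x| * `|y|;
  cstar_norm : forall x, `|cmul (star x) x| = `|x| ^+ 2
}.

#[short(type="cStarAlgType")]
HB.structure Definition CStarAlg (R : realType) :=
  {A of CompleteNormedModule R[i] A & isCStarAlg R A}.

Notation "x ** y" := (cmul x y) (at level 40, left associativity) : ring_scope.

Record cStarSubalg (R : realType) (A : cStarAlgType R) := CStarSubalg {
  subalg_set : set A;
  subalg_closed : closed subalg_set;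
  subalg0 : subalg_set 0;
  subalgD : forall x y, subalg_set x -> subalg_set y -> subalg_set (x + y);
  subalgZ : forall (k : R[i]) x, subalg_set x -> subalg_set (k *: x);
  subalgM : forall x y, subalg_set x -> subalg_set y -> subalg_set (x ** y);
  subalg_star : forall x, subalg_set x -> subalg_set (star x)
}.

Section SubalgType.
Variables (R : realType) (A : cStarAlgType R) (B : cStarSubalg A).

Definition subalg_pred : {pred A} := fun x => x \in subalg_set B.

Lemma subalg_predP x : reflect (subalg_set B x) (x \in subalg_pred).
Proof. by apply: (iffP idP); rewrite unfold_in inE. Qed.

Fact subalg_submod_closed : submod_closed subalg_pred.
Proof.
split=> [|k x y /subalg_predP Bx /subalg_predP By]; apply/subalg_predP.
  exact: subalg0.
by apply: subalgD => //; exact: subalgZ.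
Qed.

HB.instance Definition _ :=
  GRing.isSubmodClosed.Build R[i] A subalg_pred subalg_submod_closed.

(* The C*-subalgebra B as a C*-algebra in its own right. *)
Record subalg_type := SubalgElt {
  incl : A;
  inclP : incl \in subalg_pred
}.

HB.instance Definition _ := [isSub for incl].
HB.instance Definition _ := [Choice of subalg_type by <:].
HB.instance Definition _ := [SubChoice_isSubLmodule of subalg_type by <:].

Lemma in_subalg (b : subalg_type) : subalg_set B (incl b).
Proof. exact/subalg_predP/inclP. Qed.

Definition mk_subalg x (Bx : subalg_set B x) : subalg_type :=
  SubalgElt (introT (subalg_predP x) Bx).

Lemma incl_inj : injective incl. Proof. exact: val_inj. Qed.

Fact sub_ler_normD (x y : subalg_type) :
  `|incl (x + y)| <= `|incl x| + `|incl y|.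
Proof. exact: ler_normD. Qed.

Fact sub_normrZ (k : R[i]) (x : subalg_type) :
  `|incl (k *: x)| = `|k| * `|incl x|.
Proof. exact: normrZ. Qed.

Fact sub_normr0_eq0 (x : subalg_type) : `|incl x| = 0 -> x = 0.
Proof. by move=> /normr0_eq0 x0; apply: incl_inj. Qed.

HB.instance Definition _ := Lmodule_isNormed.Build R[i] subalg_type
  sub_ler_normD sub_normrZ sub_normr0_eq0.

Lemma norm_incl (x : subalg_type) : `|incl x| = `|x|. Proof. by []. Qed.

Lemma inclB (x y : subalg_type) : incl (x - y) = incl x - incl y.
Proof. by []. Qed.

Fact subalg_complete (F : set_system subalg_type) :
  ProperFilter F -> cauchy F -> cvg F.
Proof.
move=> FF /cauchy_ballP Fc.
have cG : cauchy (incl @ F).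
  apply/cauchy_ballP => e e0; have := Fc e e0.
  case=> -[P Q] /= [FP FQ] PQ.
  exists ([set incl x | x in P], [set incl x | x in Q]) => /=.
    split; [apply: filterS FP|apply: filterS FQ] => x Px; by exists x.
  move=> [_ _] /= [[x Px <-] [y Qy <-]].
  have := PQ (x, y) (conj Px Qy); rewrite /= -!ball_normE /=.
  by rewrite -norm_incl inclB.
have [l Fl] : exists l : A, incl @ F --> l.
  by apply/cvg_ex; exact: cauchy_cvg.
have Bl : subalg_set B l.
  apply: (closed_cvg _ (@subalg_closed _ _ B) _ _ Fl).
  by apply: nearW => x; exact: in_subalg.
apply/cvg_ex; exists (mk_subalg Bl).
apply/cvgrPdist_lt => e e0.
by move/cvgrPdist_lt : Fl => /(_ e e0); apply: filterS => x; rewrite -norm_incl.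
Qed.

HB.instance Definition _ := Uniform_isComplete.Build subalg_type subalg_complete.

Definition sub_cmul (x y : subalg_type) : subalg_type :=
  mk_subalg (subalgM (in_subalg x) (in_subalg y)).
Definition sub_star (x : subalg_type) : subalg_type :=
  mk_subalg (subalg_star (in_subalg x)).

Fact sub_cmulA : associative sub_cmul.
Proof. by move=> x y z; apply: incl_inj; exact: cmulA. Qed.
Fact sub_cmulDl : left_distributive sub_cmul +%R.
Proof. by move=> x y z; apply: incl_inj; exact: cmulDl. Qed.
Fact sub_cmulDr : right_distributive sub_cmul +%R.
Proof. by move=> x y z; apply: incl_inj; exact: cmulDr. Qed.
Fact sub_cmulZl (k : R[i]) x y : sub_cmul (k *: x) y = k *: sub_cmul x y.
Proof. by apply: incl_inj; exact: cmulZl. Qed.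
Fact sub_cmulZr (k : R[i]) x y : sub_cmul x (k *: y) = k *: sub_cmul x y.
Proof. by apply: incl_inj; exact: cmulZr. Qed.
Fact sub_starK : involutive sub_star.
Proof. by move=> x; apply: incl_inj; exact: starK. Qed.
Fact sub_starD : {morph sub_star : x y / x + y}.
Proof. by move=> x y; apply: incl_inj; exact: starD. Qed.
Fact sub_starZ (k : R[i]) x : sub_star (k *: x) = k^* *: sub_star x.
Proof. by apply: incl_inj; exact: starZ. Qed.
Fact sub_starM x y :
  sub_star (sub_cmul x y) = sub_cmul (sub_star y) (sub_star x).
Proof. by apply: incl_inj; exact: starM. Qed.
Fact sub_cnormM x y : `|sub_cmul x y| <= `|x| * `|y|.
Proof. exact: cnormM. Qed.
Fact sub_cstar_norm x : `|sub_cmul (sub_star x) x| = `|x| ^+ 2.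
Proof. exact: cstar_norm. Qed.

HB.instance Definition _ := isCStarAlg.Build R subalg_type
  sub_cmulA sub_cmulDl sub_cmulDr sub_cmulZl sub_cmulZr
  sub_starK sub_starD sub_starZ sub_starM sub_cnormM sub_cstar_norm.

End SubalgType.

Section States.
Variables (R : realType) (A : cStarAlgType R).
Implicit Types (f g h : A -> R[i]) (x y : A).

Definition cpositive x := exists y, x = star y ** y.

(* The operator norm of a linear functional, as a real number.  The supremum of
   an unbounded set is 0, so [fnorm f = 1] entails that f is bounded. *)
Definition fnorm f : R :=
  sup [set complex.Re `|f x| | x in [set x : A | `|x| <= 1]].

(* The order of R[i] makes [0 <= z] say that z is real and nonnegative. *)
Definition is_state f :=
  [/\ scalar f, forall x, 0 <= f (star x ** x) & fnorm f = 1].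

Definition convex_comb (X : Type) (t : R) (f g : X -> R[i]) : X -> R[i] :=
  fun x : X => t%:C * f x + (1 - t)%:C * g x.

(* Pure states are the extreme points of the set of states. *)
Definition pure_state f := is_state f /\
  forall g h (t : R), is_state g -> is_state h -> 0 < t < 1 ->
    f = convex_comb t g h -> g = f /\ h = f.

Definition tracial_states : set (A -> R[i]) :=
  [set f | is_state f /\ forall x y, f (x ** y) = f (y ** x)].

(* Nets are represented by the filters of their tails. *)
Definition approximate_unit (F : set_system A) := [/\ ProperFilter F,
  (\forall e \near F, cpositive e /\ `|e| <= 1),
  (forall x, e ** x @[e --> F] --> x) &
  (forall x, x ** e @[e --> F] --> x)].

End States.

Section Inclusions.
Variables (R : realType) (A : cStarAlgType R) (B : cStarSubalg A).

Definition abelian_subalg :=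
  forall x y, subalg_set B x -> subalg_set B y -> x ** y = y ** x.

Definition nondegenerate_inclusion :=
  exists2 F, approximate_unit F & (\forall e \near F, subalg_set B e).

Definition normalizer : set A := [set n | forall b, subalg_set B b ->
  subalg_set B (n ** b ** star n) /\ subalg_set B (star n ** b ** n)].

Definition regular_inclusion := forall S : cStarSubalg A,
  normalizer `<=` subalg_set S -> subalg_set S = setT.

Definition subalg_restrict (f : A -> R[i]) : subalg_type B -> R[i] :=
  f \o @incl R A B.

Definition extension_property := forall phi : subalg_type B -> R[i],
  pure_state phi -> exists! f, is_state f /\ subalg_restrict f = phi.

(* Complete positivity is not listed: by B-bimodularity,
   sum_ij b_i^* E(a_i^* a_j) b_j = E(c^* c) with c = sum_i a_i b_i. *)
Definition conditional_expectation (E : A -> subalg_type B) :=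
  [/\ linear E,
      forall x, cpositive x -> cpositive (E x),
      forall x, `|E x| <= `|x|,
      forall b, E (incl b) = b &
      forall b x, E (incl b ** x) = b ** E x /\ E (x ** incl b) = E x ** b].

(* Below c and d stand for n b n^* and n^* n b seen in B; the latter belongs to
   B when the inclusion is non-degenerate, see normalizer_star_mul. *)
Definition fully_invariant (phi : subalg_type B -> R[i]) :=
  forall (n : A) (b c d : subalg_type B), normalizer n ->
    incl c = n ** incl b ** star n -> incl d = star n ** n ** incl b ->
    phi c = phi d.

Definition invariant_states : set (subalg_type B -> R[i]) :=
  [set phi | is_state phi /\ fully_invariant phi].

Lemma normalizer_star_mul n b : nondegenerate_inclusion ->
  normalizer n -> subalg_set B b -> subalg_set B (star n ** n ** b).
Proof.
move=> [F [FF _ eF _] FB] nN Bb; apply: subalgM => //.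
have /(closed_cvg _ (@subalg_closed _ _ B)) :
    \forall e \near F, subalg_set B (star n ** (e ** n)).
  by apply: filterS FB => e /nN[_]; rewrite cmulA.
apply; apply/cvgrPdist_lt => eps eps0.
have c0 : 0 < `|star n| + 1 by rewrite ltr_wpDl.
have := eF n; move/cvgrPdist_lt => /(_ (eps / (`|star n| + 1))).
rewrite divr_gt0// => /(_ isT); apply: filterS => e ne.
have -> : star n ** n - star n ** (e ** n) = star n ** (n - e ** n).
  by rewrite cmulDr -[in RHS]scaleN1r cmulZr scaleN1r.
apply: le_lt_trans (cnormM _ _) _.
apply: (@le_lt_trans _ _ ((`|star n| + 1) * `|n - e ** n|)).
  by rewrite ler_wpM2r// lerDl.
by rewrite mulrC -ltr_pdivlMr.
Qed.

End Inclusions.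

Arguments tracial_states {R} A _.
Arguments invariant_states {R A} B _.

Section AffineHomeomorphisms.

Definition affine_on (R : realType) (X Y : Type) (S : set (X -> R[i]))
    (u : (X -> R[i]) -> (Y -> R[i])) :=
  forall f g (t : R), S f -> S g -> 0 <= t <= 1 ->
    u (convex_comb t f g) = convex_comb t (u f) (u g).

Definition homeomorphism_on (X Y : topologicalType) (S : set X) (T : set Y)
    (u : X -> Y) (v : Y -> X) :=
  [/\ set_fun S T u, set_fun T S v,
      (forall x, S x -> v (u x) = x), (forall y, T y -> u (v y) = y) &
      {within S, continuous u} /\ {within T, continuous v}].

(* On sets of states the w*-topology is induced by pointwise convergence. *)
Definition affine_wstar_homeomorphism (R : realType) (X Y : Type)
    (S : set (X -> R[i])) (T : set (Y -> R[i]))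
    (u : (X -> R[i]) -> (Y -> R[i])) (v : (Y -> R[i]) -> (X -> R[i])) :=
  affine_on S u /\
  @homeomorphism_on {ptws X -> (R[i])^o} {ptws Y -> (R[i])^o} S T u v.

End AffineHomeomorphisms.

(* Main.v *)
Require Import Defs.
From mathcomp Require Import all_boot all_order all_algebra.
From mathcomp Require Import all_classical all_reals.
From mathcomp Require Import topology normedtype derive.
From mathcomp Require Import complex.
From mathcomp Require Import ring lra.

(** Only one implication on each side of the correspondence has content: a
    tracial state [tau] has to satisfy [tau = tau \o E], and for an invariant
    state [phi] the state [phi \o E] has to be tracial.

    Both rest on one statement ([central_expectation]): a positive functional
    [u] on [A] with [u (b x) = u (x b)] for all [b] in [B] satisfies
    [u = u \o E]. The contractive functionals of this kind form a weak-*
    compact convex set, so by the Krein-Milman argument it is enough to look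
    at its extreme points. If [v] is extreme and [h = c^* c] with [c] in the
    unit ball of [B], then [x |-> v (h x)] and [x |-> v ((1 - h) x)] are both
    positive by centrality, and extremality forces [v (h x) = v h * v x]. Hence
    [v] is multiplicative on [B], so it restricts to a pure state of [B]; since
    [v] and [v \o E] both extend that pure state, the extension property makes
    them equal.

    A tracial state is such a functional, which settles the first implication.
    For the second, let [u = phi \o E] and let [n] be a normalizer in the unit
    ball. With [beta = n^* n] and [m = n beta], the functional
    [x |-> u (m^* x m)] is again central ([conj_central]), so by invariance of
    [phi]
<<
      u (m^* x m) = u (m^* E(x) m) = u (m m^* E(x)) = u (m m^* x).
>>
    Taking [x = m z] gives [D (beta^4 z) = 0] for [D z = u (n z) - u (z n)].
    The factors [beta] are cancelled one at a time ([commutator_vanishes]):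
    [D] does not change under multiplication by [1 - beta], while [n (1 - beta)^k]
    tends to zero in the Gelfand-Naimark-Segal seminorm of [u]. So [n] commutes
    with everything under [u], and regularity extends this to all of [A].

    No spectral theory enters. Functionals are handled through their real
    parts, for which [u (x^* y)] is a real semi-inner product, and each
    operator inequality is the Cauchy-Schwarz inequality iterated along the
    powers of a selfadjoint element ([contraction_of_bounded_orbit]). *)

Set Implicit Arguments.
Unset Strict Implicit.
Unset Printing Implicit Defensive.
Import Order.TTheory GRing.Theory Num.Theory.
Import numFieldNormedType.Exports.
Local Open Scope classical_set_scope.
Local Open Scope ring_scope.
Local Open Scope complex_scope.
Local Notation Re := complex.Re.
Local Notation Im := complex.Im.

(** * Norms, products and the involution *)

Section StarAlgebra.
Variables (R : realType) (A : cStarAlgType R).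
Implicit Types (x y z : A) (r : R) (k : R[i]).

(** Norms take values in [R[i]], where they are real; estimates are carried out
    in [R]. *)
Definition nrm x : R := Re `|x|.

Lemma nrmE x : `|x| = (nrm x)%:C.
Proof. by rewrite RRe_real// ger0_real. Qed.

Lemma nrm_ge0 x : 0 <= nrm x.
Proof. by rewrite -ler0c -nrmE. Qed.

Lemma nrm_le x r : (`|x| <= r%:C) = (nrm x <= r).
Proof. by rewrite nrmE lecR. Qed.

Lemma nrmD x y : nrm (x + y) <= nrm x + nrm y.
Proof. by rewrite -lecR rmorphD /= -!nrmE ler_normD. Qed.

Lemma nrmZ k x : nrm (k *: x) = Re `|k| * nrm x.
Proof. by rewrite /nrm normrZ [`|x|]nrmE normc_def /= mul0r subr0. Qed.

Lemma nrmZr r x : nrm (r%:C *: x) = `|r| * nrm x.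
Proof. by rewrite nrmZ normc_def /= expr0n addr0 sqrtr_sqr. Qed.

Lemma nrmM x y : nrm (x ** y) <= nrm x * nrm y.
Proof. by rewrite -lecR rmorphM /= -!nrmE cnormM. Qed.

Lemma nrm_starM x : nrm (star x ** x) = nrm x ^+ 2.
Proof. by apply: complexI; rewrite rmorphXn /= -!nrmE cstar_norm. Qed.

Lemma nrm_star x : nrm (star x) = nrm x.
Proof.
suff le_star y : nrm y <= nrm (star y).
  by apply/le_anti; rewrite le_star andbT -[leRHS](congr1 nrm (starK x)) le_star.
have [->|y0] := eqVneq (nrm y) 0; first exact: nrm_ge0.
have y1 : 0 < nrm y by rewrite lt_neqAle eq_sym y0 nrm_ge0.
by rewrite -(ler_pM2r y1) -expr2 -nrm_starM nrmM.
Qed.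

Lemma cmul0l x : 0 ** x = 0.
Proof. by have := cmulZl 0 0 x; rewrite !scale0r. Qed.

Lemma cmul0r x : x ** 0 = 0.
Proof. by have := cmulZr 0 x 0; rewrite !scale0r. Qed.

Lemma cmulNl x y : (- x) ** y = - (x ** y).
Proof. by rewrite -scaleN1r cmulZl scaleN1r. Qed.

Lemma cmulNr x y : x ** (- y) = - (x ** y).
Proof. by rewrite -scaleN1r cmulZr scaleN1r. Qed.

Lemma cmulBl x y z : (x - y) ** z = x ** z - y ** z.
Proof. by rewrite cmulDl cmulNl. Qed.

Lemma cmulBr x y z : x ** (y - z) = x ** y - x ** z.
Proof. by rewrite cmulDr cmulNr. Qed.

Lemma star0 : star (0 : A) = 0.
Proof. by have := starZ 0 (0 : A); rewrite rmorph0 !scale0r. Qed.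

Lemma starN x : star (- x) = - star x.
Proof. by rewrite -scaleN1r starZ rmorphN rmorph1 scaleN1r. Qed.

Lemma starB x y : star (x - y) = star x - star y.
Proof. by rewrite starD starN. Qed.

Lemma starZr r x : star (r%:C *: x) = r%:C *: star x.
Proof. by rewrite starZ -[(_^*)%R]/(conjc _) conjc_real. Qed.

Lemma starZi x : star ('i *: x) = - ('i *: star x).
Proof. by rewrite starZ -scaleNr; congr (_ *: _); apply/eqP; rewrite eq_complex /= oppr0 !eqxx. Qed.

Lemma scaleii x : 'i *: ('i *: x) = - x.
Proof. by rewrite scalerA -expr2 sqr_i scaleN1r. Qed.

Lemma scaleCi r x : r%:C *: ('i *: x) = 'i *: (r%:C *: x).
Proof. by rewrite !scalerA mulrC. Qed.

Lemma scaleE k x : k *: x = (Re k)%:C *: x + (Im k)%:C *: ('i *: x).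
Proof. by rewrite [k in LHS]complexE scalerDl scalerA mulrC. Qed.

End StarAlgebra.

(** * Growth arguments *)

Section Growth.
Variable R : realType.
Implicit Types (a b M : R).

Lemma le0_of_le_eps a M : (forall e, 0 < e -> a <= M * e) -> a <= 0.
Proof.
move=> h; apply/ler_addgt0Pl => e e0; rewrite addr0.
have k0 : 0 < `|M| + 1 by rewrite ltr_wpDl.
apply: le_trans (h (e / (`|M| + 1)) _) _; first by rewrite divr_gt0.
by rewrite mulrA ler_pdivrMr// mulrC ler_pM2l// (le_trans (ler_norm _)) ?lerDl.
Qed.

Lemma le0_of_natmul_le a M : (forall k : nat, k%:R * a <= M) -> a <= 0.
Proof.
move=> h; rewrite leNgt; apply/negP => a0.
have := h (Num.Def.truncn (`|M| / a)).+1; apply/negP; rewrite -ltNge.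
by rewrite -ltr_pdivrMr// (le_lt_trans _ (truncnS_gt _))// ler_pM2r ?invr_gt0 ?ler_norm.
Qed.

(** Bernoulli's inequality makes the powers of a ratio [a / b > 1] unbounded. *)
Lemma le_of_expr_le (I : set nat) a b M :
  (forall n, exists2 m, I m & (n <= m)%N) -> 0 <= a -> 0 <= b ->
  (forall n, I n -> a ^+ n <= M * b ^+ n) -> a <= b.
Proof.
move=> unbI a0 b0 h; rewrite leNgt; apply/negP => ab.
have a1 : 0 < a by exact: le_lt_trans ab.
have [b1|b1] := eqVneq b 0.
  have [m Im m1] := unbI 1%N; have := h m Im.
  by rewrite b1 expr0n eqn0Ngt m1 mulr0 leNgt exprn_gt0.
have {b1}b1 : 0 < b by rewrite lt_neqAle eq_sym b1.
pose d := a / b - 1; have d0 : 0 < d by rewrite subr_gt0 ltr_pdivlMr// mul1r.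
have bern n : 1 + n%:R * d <= (a / b) ^+ n.
  have -> : a / b = 1 + d by rewrite /d addrC subrK.
  elim: n => [|n IH]; first by rewrite mul0r addr0 expr0.
  rewrite exprS -natr1; apply: le_trans (_ : (1 + d) * (1 + n%:R * d) <= _).
    by have := ler0n R n; nra.
  by rewrite ler_pM2l//; lra.
have Md n : I n -> 1 + n%:R * d <= M.
  move=> In; apply: le_trans (bern n) _.
  by rewrite expr_div_n ler_pdivrMr ?exprn_gt0// h.
have [m Im mM] := unbI (Num.Def.truncn (`|M| / d)).+1.
have := Md _ Im; apply/negP; rewrite -ltNge.
have : `|M| / d < m%:R.
  by apply: lt_le_trans (truncnS_gt _) _; rewrite ler_nat.
rewrite ltr_pdivrMr// => /(le_lt_trans (ler_norm _)); lra.
Qed.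

(** Log-convexity of [j |-> q (S^j x)]: a first increase would persist
    geometrically. *)
Lemma contraction_of_bounded_orbit (V : Type) (q : V -> R) (S : V -> V) x M :
  (forall y, 0 <= q y) -> (forall y, q (S y) ^+ 2 <= q y * q (S (S y))) ->
  (forall j, q (iter j S x) <= M) -> q (S x) <= q x.
Proof.
move=> q0 qS qM; have [qx|qx] := eqVneq (q x) 0.
  have := qS x; rewrite qx mul0r; have := q0 (S x); nra.
have {qx}qx : 0 < q x by rewrite lt_neqAle eq_sym qx q0.
rewrite leNgt; apply/negP => lt.
have [s s1 sE] : exists2 s, 1 < s & q (S x) = s * q x.
  by exists (q (S x) / q x); rewrite ?ltr_pdivlMr ?mul1r// divfK// gt_eqF.
have H j : 0 < q (iter j S x) /\ s * q (iter j S x) <= q (iter j.+1 S x).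
  elim: j => [|j [IH1 IH2]]; first by rewrite /= sE.
  have p1 : 0 < q (iter j.+1 S x) by apply: lt_le_trans IH2; nra.
  split => //; have := qS (iter j S x); rewrite -!iterS => h.
  rewrite -(ler_pM2l IH1) (le_trans _ h)// mulrA expr2 ler_pM2r// mulrC//.
have {}H j : s ^+ j * q x <= q (iter j S x).
  elim: j => [|j IH]; first by rewrite mul1r.
  rewrite exprS -mulrA; apply: le_trans (H j).2; rewrite ler_pM2l//; lra.
have : s <= 1.
  apply: (@le_of_expr_le setT _ _ (M / q x)) => //; last 1 first.
  - by move=> n _; rewrite expr1n mulr1 ler_pdivlMr// (le_trans (H n)).
  - by move=> n; exists n.
  - by lra.
by rewrite leNgt s1.
Qed.

End Growth.

(** * Positive functionals, through their real parts *)

Section PositiveFunctionals.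
Variables (R : realType) (A : cStarAlgType R).
Implicit Types (x y z a : A) (r : R) (u w : A -> R).

(** [u] stands for the real part of a positive functional [f], which
    [complexify] recovers. The fourth condition says that [f] is real at the
    elements [x^* x]. *)
Definition pos_functional u :=
  [/\ forall x y, u (x + y) = u x + u y,
      forall r x, u (r%:C *: x) = r * u x,
      forall x, 0 <= u (star x ** x),
      forall x, u ('i *: (star x ** x)) = 0 &
      exists M, forall x, `|u x| <= M * nrm x].

Definition contractive u := forall x, `|u x| <= nrm x.

(** The net of an approximate unit enters only through its ability to serve
    finitely many elements at once. *)
Definition has_units (B : set A) := forall (s : seq A) (eps : R), 0 < eps ->
  exists e, [/\ B e, star e = e, nrm e <= 1 &
                all (fun x => nrm (x - e ** x) < eps) s].

Section Theory.
Variable u : A -> R.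
Hypothesis pu : pos_functional u.

Lemma posD x y : u (x + y) = u x + u y. Proof. by case: pu. Qed.
Lemma posZ r x : u (r%:C *: x) = r * u x. Proof. by case: pu. Qed.
Lemma pos_ge0 x : 0 <= u (star x ** x). Proof. by case: pu. Qed.
Lemma pos_i x : u ('i *: (star x ** x)) = 0. Proof. by case: pu. Qed.

Lemma posN x : u (- x) = - u x.
Proof. by rewrite -scaleN1r -(rmorphN1 (real_complex R)) posZ mulN1r. Qed.

Lemma posB x y : u (x - y) = u x - u y.
Proof. by rewrite posD posN. Qed.

Lemma pos0 : u 0 = 0.
Proof. by have := posB 0 0; rewrite !subrr. Qed.

Lemma pos_bound : exists2 M, 0 <= M & forall x, `|u x| <= M * nrm x.
Proof.
case: pu => _ _ _ _ [M uM]; exists `|M| => // x.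
by rewrite (le_trans (uM x))// ler_wpM2r ?nrm_ge0 ?ler_norm.
Qed.

(** Polarization of [u ('i *: z^* z) = 0]. *)
Lemma pos_sym x y : u (star x ** y) = u (star y ** x).
Proof.
have := pos_i (x + 'i *: y).
rewrite starD starZi !(cmulDl, cmulDr, cmulNl) !cmulZl !cmulZr !scaleii.
rewrite !(scalerDr, scalerN, scaleii) !(posD, posN) !pos_i; lra.
Qed.

Lemma pos_cauchy_schwarz x y :
  u (star x ** y) ^+ 2 <= u (star x ** x) * u (star y ** y).
Proof.
(* Positivity of [u] at the combination [t x + s y]. *)
have E (t s : R) : 0 <= t ^+ 2 * u (star x ** x) + 2 * (t * s) * u (star x ** y)
    + s ^+ 2 * u (star y ** y).
  have := pos_ge0 (t%:C *: x + s%:C *: y).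
  rewrite starD !starZr !(cmulDl, cmulDr) !cmulZl !cmulZr !(posD, posZ).
  by rewrite (pos_sym y x) !expr2; lra.
have p := pos_ge0 x; have q := pos_ge0 y.
move: E p q; set a := u (star x ** x); set b := u _; set c := u _ => E p q.
have [c0|c0] := eqVneq c 0; last first.
  have := E c (- b); rewrite sqrrN; have : 0 < c by lra.
  by move=> c1 h; rewrite -subr_ge0 -(pmulr_rge0 _ c1); move: h; nra.
suff -> : b = 0 by rewrite expr0n mulr_ge0.
apply/eqP; apply/negPn/negP => b0.
have := E 1 (- (a + 1) / (2 * b)); rewrite c0 mulr0 addr0 expr1n !mul1r.
have -> : 2 * (- (a + 1) / (2 * b)) * b = - (a + 1).
  by field; rewrite b0.
lra.
Qed.

(** For [h = a^* a] the orbit of [x] under multiplication by [h] is bounded in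
    norm, so [h] is a contraction for the form of [u]; Cauchy-Schwarz passes
    from [h] to [a]. *)
Lemma pos_mulr a x : nrm a <= 1 ->
  u (star (a ** x) ** (a ** x)) <= u (star x ** x).
Proof.
pose q y := u (star y ** y).
have sa h : nrm h <= 1 -> star h = h -> q (h ** x) <= q x.
  move=> h1 sh; have [M M0 uM] := pos_bound.
  apply: (@contraction_of_bounded_orbit _ _ q (cmul h) _ (M * nrm x ^+ 2)).
  - by move=> y; exact: pos_ge0.
  - move=> y; rewrite /q [u (star (h ** y) ** _)](_ : _ = u (star y ** (h ** (h ** y)))).
      exact: pos_cauchy_schwarz.
    by rewrite starM sh !cmulA.
  - move=> j; have : nrm (iter j (cmul h) x) <= nrm x.
      elim: j => //= j IH; apply: le_trans (nrmM _ _) _.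
      by rewrite -[leRHS]mul1r ler_pM ?nrm_ge0.
    move=> hj; apply: le_trans (ler_norm _) (le_trans (uM _) _).
    by rewrite nrm_starM ler_wpM2l// lerXn2r ?nnegrE ?nrm_ge0.
move=> a1; rewrite -/(q (a ** x)) -/(q x).
have aa1 : nrm (star a ** a) <= 1 by rewrite nrm_starM expr_le1 ?nrm_ge0.
have := sa _ aa1; rewrite starM starK => /(_ erefl) h.
have c : q (a ** x) ^+ 2 <= q x * q (star a ** a ** x).
  rewrite {1}/q starM -cmulA (cmulA (star a)).
  exact: pos_cauchy_schwarz.
have q0 y : 0 <= q y by exact: pos_ge0.
have := q0 x; have := q0 (a ** x); have := q0 (star a ** a ** x); nra.
Qed.

End Theory.

(** Each step lowers [q y = u (y^* y)] by at least [q (n y)], and [q (n y)] itself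
    decreases along the way; so its [k]-th value is at most [q x / k]. This is
    how [n (1 - n^* n)^k] tends to zero in the form of [u]. *)
Lemma pos_iter_sub u n x k : pos_functional u -> nrm n <= 1 ->
  let y := iter k (fun y => y - star n ** n ** y) x in
  k%:R * u (star (n ** y) ** (n ** y)) <= u (star x ** x).
Proof.
move=> pu n1 /=; set T := fun y => _; pose q y := u (star y ** y).
have q0 y : 0 <= q y by exact: pos_ge0.
have qT m y : nrm m <= 1 -> q (y - star m ** m ** y) <= q y - q (m ** y).
  move=> m1; have sm1 : nrm (star m) <= 1 by rewrite nrm_star.
  have h : q (star m ** m ** y) <= q (m ** y).
    by rewrite -cmulA; exact: pos_mulr.
  have e1 : u (star y ** (star m ** m ** y)) = q (m ** y).
    by rewrite /q starM !cmulA.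
  have e2 : u (star (star m ** m ** y) ** y) = q (m ** y).
    by rewrite pos_sym.
  rewrite {1}/q starB cmulBl !cmulBr !(posB pu) e1 e2.
  rewrite -/(q y) -/(q (star m ** m ** y)); lra.
have qnT y : q (n ** T y) <= q (n ** y).
  have -> : n ** T y = n ** y - star (star n) ** star n ** (n ** y).
    by rewrite starK /T cmulBr !cmulA.
  have := qT (star n) (n ** y); rewrite nrm_star => /(_ n1).
  by have := q0 (star n ** (n ** y)); lra.
suff : k%:R * q (n ** iter k T x) + q (iter k T x) <= q x.
  by have := q0 (iter k T x); rewrite -/(q (n ** iter k T x)) -/(q x); lra.
elim: k => [|k IH]; first by rewrite mul0r add0r.
have h1 := qT n (iter k T x) n1; have h2 := qnT (iter k T x).
rewrite -/(T (iter k T x)) -iterS in h1; rewrite -iterS in h2.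
rewrite -natr1; have := ler0n R k; nra.
Qed.

End PositiveFunctionals.

(** * Extreme points of compact sets of real functions *)

Section ExtremePoints.
Variables (R : realType) (X : eqType).
Implicit Types (K F G : set {ptws X -> R}) (u v w : X -> R).

Definition midpoint v w : X -> R := fun x => (v x + w x) / 2.

(** Midpoints are enough to single out the extreme points of a convex set. *)
Definition extreme K v := K v /\
  forall w1 w2, K w1 -> K w2 -> v = midpoint w1 w2 -> w1 = v /\ w2 = v.

(** The analogue of a nonempty closed face. *)
Definition extremal K F := [/\ F `<=` K, F !=set0, closed F &
  forall w1 w2, K w1 -> K w2 -> F (midpoint w1 w2) -> F w1 /\ F w2].

Lemma ptws_eval_continuous (x : X) : continuous (fun v : {ptws X -> R} => v x).
Proof. exact: (@proj_continuous X (fun=> R) x). Qed.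

Lemma argmax_extremal K F x : compact K -> extremal K F ->
  extremal K [set v | F v /\ forall w, F w -> w x <= v x].
Proof.
move=> cK [FK F0 cF Fe].
have kF : compact F by exact: subclosed_compact cF cK FK.
have cx : {within F, continuous (fun v : {ptws X -> R} => v x)}.
  by apply: continuous_subspaceT => v; exact: ptws_eval_continuous.
have [c /set_mem Fc cmax] := compact_EVT_max F0 kF cx.
have cmax' w : F w -> w x <= c x by move=> Fw; apply: cmax; rewrite inE.
split.
- by move=> v [/FK].
- by exists c.
- have -> : [set v | F v /\ forall w, F w -> w x <= v x] =
      F `&` (fun v : {ptws X -> R} => v x) @^-1` [set r | c x <= r].
    apply/seteqP; split=> v /= [Fv h]; split => //; first exact: h.
    by move=> w /cmax' /le_trans; apply.
  apply: closedI => //; apply: preimage_closed; last exact: closed_ge.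
  by move=> v _; exact: ptws_eval_continuous.
- move=> w1 w2 K1 K2 [Fm h]; have [F1 F2] := Fe _ _ K1 K2 Fm.
  have := h _ F1; have := h _ F2; rewrite /midpoint => h2 h1.
  by split; split => // w /h; rewrite /midpoint => h3; lra.
Qed.

(** Compactness makes a chain of extremal sets meet in an extremal set. *)
Lemma extremal_bigcap K F0 (C : set (set {ptws X -> R})) : compact K ->
  extremal K F0 -> C `<=` extremal K -> total_on C subset ->
  (forall F, C F -> F `<=` F0) ->
  extremal K (F0 `&` \bigcap_(F in C) F).
Proof.
move=> cK eF0 eC tC CF0; have [F0K F00 cF0 F0e] := eF0.
split.
- by move=> v [/F0K].
- pose D := C `|` [set F0].
  have eD F : D F -> extremal K F by case=> [/eC//|->].
  have tD F G : D F -> D G -> F `<=` G \/ G `<=` F.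
    move=> [CF|->] [CG|->]; [exact: tC|left; exact: CF0|right; exact: CF0|by left].
  pose G : set_system {ptws X -> R} := [set P | exists2 F, D F & F `<=` P].
  have FG : ProperFilter G.
    split; first by move=> [F /eD[_ [v Fv] _ _] /(_ v Fv)].
    split; first by exists F0 => //; right.
      move=> P Q [F DF FP] [F' DF' FQ].
      by have [s|s] := tD _ _ DF DF'; [exists F|exists F'] => // v h;
        split; [apply: FP|apply: FQ|apply: FP|apply: FQ] => //; exact: s.
    by move=> P Q PQ [F DF FP]; exists F => // v /FP /PQ.
  have [|p [Kp pG]] := cK G FG; first by exists F0 => //; right.
  have pD F : D F -> F p.
    move=> DF; have [_ _ cF _] := eD _ DF; apply: cF.
    by move=> V Vp; apply: pG => //; exists F.
  by exists p; split=> [|F CF]; apply: pD; [right|left].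
- by apply: closedI => //; apply: closed_bigI => F /eC[].
- move=> w1 w2 K1 K2 [F0m Cm]; have [F01 F02] := F0e _ _ K1 K2 F0m.
  by split; split=> // F CF; have [_ _ _ /(_ _ _ K1 K2 (Cm _ CF))[]] := eC _ CF.
Qed.

(** The Krein-Milman argument: a minimal extremal set inside the set of
    maximizers of [x] is a single point, as any other coordinate would cut out
    a smaller one. *)
Lemma exists_extreme_max K u x : compact K -> K u ->
  exists2 v, extreme K v & forall w, K w -> w x <= v x.
Proof.
move=> cK Ku.
have hK : hausdorff_space {ptws X -> R}.
  by apply: hausdorff_product => _; exact: order_hausdorff.
have eK : extremal K K by split=> //; [exists u|exact: compact_closed].
set F0 := [set v | K v /\ forall w, K w -> w x <= v x].
have eF0 : extremal K F0 by exact: argmax_extremal eK.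
(* A minimal extremal subset of F0 is the complement of a maximal G, which
   suits the version of Zorn's lemma for unions of chains. *)
have [C CP|G [eG maxG]] := @Zorn_bigcup _ (fun G => extremal K (F0 `\` G)).
  move=> tC; have -> : F0 `\` \bigcup_(X0 in C) X0 =
      F0 `&` \bigcap_(F in [set F0 `\` G | G in C]) F.
    apply/seteqP; split=> v [F0v h]; split => //.
      by move=> _ [G CG <-]; split => // Gv; apply: h; exists G.
    by move=> [G CG Gv]; have [] := h (F0 `\` G) (ex_intro2 _ _ G CG erefl).
  apply: extremal_bigcap => //.
  - by move=> _ [G CG <-]; exact: CP.
  - move=> _ _ [G CG <-] [G' CG' <-].
    by have [s|s] := tC _ _ CG CG'; [right|left] => v [F0v nG]; split => // /s.
  - by move=> _ [G CG <-] v [].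
have [_ [v [F0v Gv]] _ Ge] := eG.
have single w : (F0 `\` G) w -> w = v.
  move=> Fw; apply: funext => y; apply/eqP; apply/negPn/negP => wvy.
  have eM := argmax_extremal y cK eG.
  set M := [set _ | _] in eM.
  have ME : M = F0 `\` (F0 `\` M).
    by apply/seteqP; split=> t => [Mt|[F0t] /not_andP[//|/contrapT]];
      first by split; [have [[]] := Mt | case].
  have GM : (F0 `\` G) `<=` M.
    apply: contrapT => nGM; apply: (maxG (G `|` (F0 `\` M))); last first.
      suff -> : F0 `\` (G `|` (F0 `\` M)) = M by [].
      apply/seteqP; split => t.
        by move=> [F0t /not_orP[nG /not_andP[//|/contrapT]]].
      by move=> Mt; have [[F0t nGt] _] := Mt; split=> // -[|[]].
    split; first by left.
    move=> sG; apply: nGM => t [F0t nGt]; apply: contrapT => nMt.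
    by apply: nGt; apply: sG; right.
  have [_ h1] := GM w Fw; have [_ h2] := GM v (conj F0v Gv).
  by case/eqP: wvy; apply/le_anti; rewrite h1// h2.
exists v; last by case: F0v.
split; first by case: F0v.
move=> w1 w2 K1 K2 vE; have [] := Ge w1 w2 K1 K2; first by rewrite -vE.
by move=> /single -> /single ->.
Qed.

End ExtremePoints.

(** * States and their real parts *)

Section RealParts.
Variables (R : realType) (A : cStarAlgType R).
Implicit Types (x y : A) (u : A -> R) (f : A -> R[i]).

Definition real_part f : A -> R := fun x => Re (f x).

Definition unit_values f : set R :=
  [set Re `|f x| | x in [set x : A | `|x| <= 1]].

Lemma fnormE f : fnorm f = sup (unit_values f). Proof. by []. Qed.

Lemma functional0 f : scalar f -> f 0 = 0.
Proof. by move=> lf; have := lf (-1) 0 0; rewrite scaler0 addr0 mulN1r addNr. Qed.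

Lemma functionalZ f k x : scalar f -> f (k *: x) = k * f x.
Proof. by move=> lf; rewrite -[k *: x]addr0 lf functional0// addr0. Qed.

Lemma functionalD f x y : scalar f -> f (x + y) = f x + f y.
Proof. by move=> lf; rewrite -[x]scale1r lf mul1r scale1r. Qed.

Lemma Re_norm (z : R[i]) : `|z| = (Re `|z|)%:C.
Proof. by rewrite RRe_real// ger0_real. Qed.

Lemma Re_normM (z k : R[i]) : Re `|z * k| = Re `|z| * Re `|k|.
Proof. by rewrite normrM [`|z|]Re_norm [`|k|]Re_norm -rmorphM. Qed.

Lemma Re_le_norm (z : R[i]) : `|Re z| <= Re `|z|.
Proof.
rewrite normc_def /= -sqrtr_sqr ler_wsqrtr// lerDl sqr_ge0 //.
Qed.

Lemma Re_realM (r : R) (z : R[i]) : Re (r%:C * z) = r * Re z.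
Proof. by case: z => a b /=; rewrite mul0r subr0. Qed.

Lemma unit_values0 f : scalar f -> unit_values f 0.
Proof.
by move=> lf; exists 0; [rewrite /= normr0 ler01|rewrite functional0// normr0].
Qed.

Lemma Re_add (z k : R[i]) : Re (z + k) = Re z + Re k.
Proof. by case: z k => [a b] [c d]. Qed.

Lemma fnorm_bound f x : scalar f -> has_ubound (unit_values f) ->
  Re `|f x| <= fnorm f * nrm x.
Proof.
move=> lf ub; have [x0|x0] := eqVneq (nrm x) 0.
  have -> : x = 0 by apply/eqP; rewrite -normr_eq0 nrmE x0.
  rewrite functional0// normr0 mulr_ge0 ?nrm_ge0//= fnormE.
  by apply: ub_le_sup => //; exact: unit_values0.
have {x0} x0 : 0 < nrm x by rewrite lt_neqAle eq_sym x0 nrm_ge0.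
have : unit_values f (Re `|f ((nrm x)^-1%:C *: x)|).
  exists ((nrm x)^-1%:C *: x) => //=.
  rewrite -[1]/(1%:C) nrm_le nrmZr ger0_norm ?invr_ge0 ?nrm_ge0//.
  by rewrite mulVf ?gt_eqF.
move/(ub_le_sup ub); rewrite -fnormE functionalZ// Re_normM normc_def /= expr0n addr0.
by rewrite sqrtr_sqr ger0_norm ?invr_ge0 ?nrm_ge0// mulrC ler_pdivrMr.
Qed.

Lemma fnorm_le f M : scalar f -> (forall x, Re `|f x| <= M * nrm x) ->
  0 <= M -> fnorm f <= M.
Proof.
move=> lf fM M0; apply: ge_sup.
  by exists 0; exact: unit_values0.
move=> _ [x /= x1 <-]; apply: le_trans (fM x) _.
by rewrite -[leRHS]mulr1 ler_wpM2l// -nrm_le.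
Qed.

Lemma state_le f x : is_state f -> Re `|f x| <= nrm x.
Proof.
move=> [lf _ f1]; rewrite -[leRHS]mul1r -f1; apply: fnorm_bound => //.
apply: contrapT => nub; have : fnorm f = 0.
  by rewrite fnormE sup_out// => -[_].
by rewrite f1; move/eqP; rewrite oner_eq0.
Qed.

Lemma Re_state_pos f : is_state f -> pos_functional (real_part f).
Proof.
move=> sf; have [lf f0 _] := sf; rewrite /real_part; split.
- by move=> x y; rewrite functionalD//= raddfD.
- by move=> r x; rewrite functionalZ// Re_realM.
- by move=> x; have := f0 x; rewrite lecE => /andP[_].
- move=> x; rewrite functionalZ// mulrC ReiNIm.
  by have := f0 x; rewrite lecE => /andP[/eqP -> _]; rewrite oppr0.
- exists 1 => x; rewrite mul1r; apply: le_trans (state_le x sf); exact: Re_le_norm.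
Qed.

Lemma Re_state_contractive f : is_state f -> contractive (real_part f).
Proof.
by move=> sf x; apply: le_trans (state_le x sf); exact: Re_le_norm.
Qed.

Lemma eq_scalar_Re f g : scalar f -> scalar g -> real_part f = real_part g -> f = g.
Proof.
move=> lf lg fg; apply: funext => x; apply/eqP; rewrite eq_complex.
have := congr1 (@^~ ('i *: x)) fg; rewrite /real_part /= !functionalZ// !(mulrC 'i%C) !ReiNIm.
by move=> /oppr_inj ->; have := congr1 (@^~ x) fg; rewrite /real_part /= => ->; rewrite !eqxx.
Qed.

(** A complex functional is determined by its real part, as
    [Im (f x) = - Re (f ('i *: x))]. *)
Definition complexify u : A -> R[i] := fun x => u x +i* - u ('i *: x).

Lemma complexify_scalar u : pos_functional u -> scalar (complexify u).
Proof.
move=> pu k x y; rewrite /complexify scalerDr !(posD pu) !(scaleE k) scalerDr.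
rewrite -(scaleCi _ x) -(scaleCi _ ('i *: x)) scaleii !(posD pu) !(posZ pu) (posN pu).
by apply/eqP; rewrite eq_complex; case: k => a b /=; apply/andP; split; apply/eqP; ring.
Qed.

Lemma complexify_ge0 u x : pos_functional u -> 0 <= complexify u (star x ** x).
Proof.
by move=> pu; rewrite lecE /= (pos_i pu) oppr0 eqxx (pos_ge0 pu).
Qed.

(** A phase [k] turns [f x] into [`|f x|], the real part of [f (k *: x)]. *)
Lemma scalar_le f M x : scalar f -> (forall x, `|Re (f x)| <= M * nrm x) ->
  Re `|f x| <= M * nrm x.
Proof.
move=> lf fM; have [fx|fx] := eqVneq (f x) 0.
  by rewrite fx normr0; apply: le_trans (fM x); exact: normr_ge0.
pose k := `|f x| / f x; have k1 : `|k| = 1.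
  by rewrite /k normrM normfV normr_id divff// normr_eq0.
have := fM (k *: x); rewrite functionalZ// /k divfK// nrmZ k1 mul1r.
by apply: le_trans; exact: ler_norm.
Qed.

(** The last hypothesis says that the norm of [u] is not less than one. *)
Lemma complexify_state u : pos_functional u -> contractive u ->
  (forall s, (forall x, `|u x| <= s * nrm x) -> 1 <= s) ->
  is_state (complexify u).
Proof.
move=> pu cu u1; have lf := complexify_scalar pu; split => //.
  by move=> x; exact: complexify_ge0.
have fle x : Re `|complexify u x| <= 1 * nrm x.
  by apply: scalar_le => // y; rewrite mul1r; exact: cu.
apply/le_anti; rewrite fnorm_le//=; apply: u1 => x.
apply: le_trans (Re_le_norm (complexify u x)) _; apply: fnorm_bound => //.
exists 1 => _ [y /= y1 <-]; apply: le_trans (fle y) _.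
by rewrite mul1r -nrm_le.
Qed.

End RealParts.

(** * Approximate units *)

Section Units.
Variables (R : realType) (A : cStarAlgType R) (B : set A) (u : A -> R).
Hypotheses (uB : has_units B) (pu : pos_functional u).

(** Cauchy-Schwarz bounds [u (e x) ^+ 2] by [u (e e) * u (x^* x)], and [e x]
    tends to [x] along the units. A bound on [u (e e)] is only asked of units
    that are close to the identity on a given finite list [l]. *)
Lemma pos_kadison (l : seq A) (delta s : R) x : 0 < delta ->
  (forall e, B e -> star e = e -> nrm e <= 1 ->
     all (fun y => nrm (y - e ** y) < delta) l -> u (e ** e) <= s) ->
  u x ^+ 2 <= s * u (star x ** x).
Proof.
move=> d0 us; rewrite -subr_le0; have [M M0 uM] := pos_bound pu.
apply: (@le0_of_le_eps _ _ (2 * `|u x| * M)) => eps eps0.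
have m0 : 0 < Num.min eps delta by rewrite lt_min eps0.
have [e [Be se e1 /= /andP[xe le]]] := uB (x :: l) m0.
have ue : u (e ** e) <= s.
  by apply: us => //; apply: sub_all le => y /lt_le_trans; apply; rewrite ge_min lexx orbT.
have := pos_cauchy_schwarz pu e x; rewrite se => cs.
have xe' : `|u (x - e ** x)| <= M * eps.
  apply: le_trans (uM _) _; rewrite ler_wpM2l//.
  by apply: le_trans (ltW xe) _; rewrite ge_min lexx.
have -> : 2 * `|u x| * M * eps = 2 * (`|u x| * (M * eps)) by rewrite !mulrA.
have : u x * u (x - e ** x) <= `|u x| * (M * eps).
  by apply: le_trans (ler_norm _) _; rewrite normrM ler_wpM2l.
rewrite (posB pu); have := pos_ge0 pu x; move: cs ue.
set a := u (e ** x); set b := u (e ** e); set c := u (star x ** x).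
set v := u x => cs ue c0 h.
have : b * c <= s * c by rewrite ler_wpM2r.
have : 0 <= (v - a) ^+ 2 by rewrite sqr_ge0.
lra.
Qed.

Lemma pos_sqr_le x : contractive u -> u x ^+ 2 <= u (star x ** x).
Proof.
move=> cu; rewrite -[leRHS]mul1r; apply: (pos_kadison (l := [::]) (delta := 1)) => //.
move=> e _ _ e1 _; apply: le_trans (ler_norm _) (le_trans (cu _) _).
by apply: le_trans (nrmM _ _) _; rewrite -[leRHS]mul1r ler_pM ?nrm_ge0.
Qed.

(** [u (e x) = u (x^* e)] for a selfadjoint [e], by symmetry of the form. *)
Lemma pos_star x : u (star x) = u x.
Proof.
have [M M0 uM] := pos_bound pu.
apply/eqP; rewrite -subr_eq0 -normr_le0; apply: (@le0_of_le_eps _ _ (2 * M)) => eps eps0.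
have [e [Be se e1 /= /andP[xe _]]] := uB [:: x] eps0.
have := pos_sym pu e x; rewrite se => h.
have h1 : `|u (x - e ** x)| <= M * eps.
  by apply: le_trans (uM _) _; rewrite ler_wpM2l// ltW.
have h2 : `|u (star x - star x ** e)| <= M * eps.
  apply: le_trans (uM _) _; rewrite ler_wpM2l//.
  by rewrite -[in star x ** e]se -starM -starB nrm_star ltW.
move: h1 h2; rewrite !(posB pu) -h !ler_norml => /andP[? ?] /andP[? ?].
by apply/andP; split; lra.
Qed.

End Units.

(** Iterating [w x ^+ 2 <= w (x^* x)] improves any bound on [w] to one. *)
Lemma contractive_of_sqr_le (R : realType) (A : cStarAlgType R) (w : A -> R) M :
  (forall x, `|w x| <= M * nrm x) ->
  (forall x, w x ^+ 2 <= w (star x ** x)) -> contractive w.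
Proof.
move=> wM w2 x.
apply: (@le_of_expr_le _ [set 2 ^ k | k in setT]%N _ _ M) => //.
- by move=> n; exists (2 ^ n)%N; [exists n|exact/ltnW/ltn_expl].
- exact: nrm_ge0.
move=> _ [k _ <-]; elim: k x => [|k IH] x; first by rewrite !expr1.
rewrite expnS !exprM real_normK ?num_real// -nrm_starM.
apply: le_trans (IH _); apply: lerXn2r; rewrite ?nnegrE ?sqr_ge0//.
exact: le_trans (w2 x) (ler_norm _).
Qed.

(** * Functionals centralized by the subalgebra *)

Section CentralFunctionals.
Variables (R : realType) (A : cStarAlgType R) (B : cStarSubalg A).
Implicit Types (x y : A) (u v w : A -> R).
Local Notation inB := (subalg_set B).

Definition central u := forall b x, inB b -> u (b ** x) = u (x ** b).

Definition central_functionals : set {ptws A -> R} :=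
  [set u | [/\ pos_functional u, contractive u & central u]].

Lemma closure_preimage (T U : topologicalType) (K : set T) (g : T -> U) C t :
  continuous g -> closed C -> K `<=` g @^-1` C -> closure K t -> C (g t).
Proof.
move=> cg cC KC /(closureS KC).
by apply: (preimage_closed _ cC) => s _; exact: cg.
Qed.

(** A closed subset of a product of intervals. *)
Lemma central_compact : compact central_functionals.
Proof.
have cbox : compact [set u : {ptws A -> R} | forall x, `[- nrm x, nrm x]%classic (u x)].
  exact: (@tychonoff A (fun=> R) (fun x => `[- nrm x, nrm x]%classic)
    (fun x => @segment_compact R _ _)).
apply: (subclosed_compact _ cbox); last first.
  by move=> u [_ cu _] x; rewrite /= in_itv /= -ler_norml.
move=> u ku.
have ev x : continuous (fun v : {ptws A -> R} => v x) by exact: ptws_eval_continuous.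
have eq0 (g : {ptws A -> R} -> R) : continuous g ->
    (forall v, central_functionals v -> g v = 0) -> g u = 0.
  move=> cg g0; apply: (closure_preimage cg (@closed_eq _ 0) _ ku).
  by move=> v /g0.
have cu : contractive u.
  move=> x; rewrite ler_norml; apply/andP; split.
    apply: (closure_preimage (ev x) (@closed_ge _ (- nrm x)) _ ku) => v [_ cv _] /=.
    by have := cv x; rewrite ler_norml => /andP[].
  apply: (closure_preimage (ev x) (@closed_le _ (nrm x)) _ ku) => v [_ cv _] /=.
  by have := cv x; rewrite ler_norml => /andP[].
split=> //.
- split.
  + move=> x y; apply/eqP; rewrite -subr_eq0 opprD addrA; apply/eqP.
    apply: (eq0 (fun v => v (x + y) - v x - v y)) => [v|v [pv _ _]].
      exact: (cvgB (cvgB (ev (x + y) v) (ev x v)) (ev y v)).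
    by rewrite (posD pv); lra.
  + move=> r x; apply/eqP; rewrite -subr_eq0; apply/eqP.
    apply: (eq0 (fun v => v (r%:C *: x) - r * v x)) => [v|v [pv _ _]].
      exact: (cvgB (ev (r%:C *: x) v) (cvgMl_tmp (ev x v))).
    by rewrite (posZ pv) subrr.
  + move=> x.
    apply: (closure_preimage (ev (star x ** x)) (@closed_ge _ 0) _ ku) => v [pv _ _].
    exact: pos_ge0.
  + move=> x; apply: (eq0 (fun v => v ('i *: (star x ** x)))) => [|v [pv _ _]].
      exact: ev.
    exact: pos_i.
  + by exists 1 => x; rewrite mul1r.
- move=> b x Bb; apply/eqP; rewrite -subr_eq0; apply/eqP.
  apply: (eq0 (fun v => v (b ** x) - v (x ** b))) => [v|v [_ _ zv]].
    exact: (cvgB (ev (b ** x) v) (ev (x ** b) v)).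
  by rewrite zv// subrr.
Qed.

Lemma pos_scale t v : 0 <= t -> pos_functional v -> pos_functional (fun x => t * v x).
Proof.
move=> t0 pv; have [M M0 vM] := pos_bound pv; split.
- by move=> x y; rewrite (posD pv) mulrDr.
- by move=> r x; rewrite (posZ pv) mulrCA.
- by move=> x; rewrite mulr_ge0// pos_ge0.
- by move=> x; rewrite (pos_i pv) mulr0.
- by exists (t * M) => x; rewrite normrM ger0_norm// -mulrA ler_wpM2l.
Qed.

(** If the norm were at most [s < 1], then [v] would be the midpoint of
    [(2 - s) v] and [s v], where [(2 - s) s <= 1]. *)
Lemma extreme_norm1 v x : extreme central_functionals v -> v x != 0 ->
  forall s, (forall y, `|v y| <= s * nrm y) -> 1 <= s.
Proof.
move=> [[pv cv zv] ev] vx0 s vs; rewrite leNgt; apply/negP => s1.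
have s0 : 0 < s.
  have : 0 < s * nrm x by apply: lt_le_trans (vs x); rewrite normr_gt0.
  by rewrite pmulr_lgt0// lt_neqAle nrm_ge0 andbT; apply/eqP => n0;
    have := vs x; rewrite -n0 mulr0 normr_le0 (negPf vx0).
have K t : 0 <= t -> t * s <= 1 -> central_functionals (fun y => t * v y).
  move=> t0 ts; split; first exact: pos_scale.
    move=> y; rewrite normrM ger0_norm//; apply: le_trans (_ : t * (s * nrm y) <= _).
      by rewrite ler_wpM2l.
    by rewrite mulrA -[leRHS]mul1r ler_wpM2r ?nrm_ge0.
  by move=> b y Bb; rewrite zv.
have [|||_] := ev (fun y => (2 - s) * v y) (fun y => s * v y).
- by apply: K; nra.
- by apply: K; nra.
- by apply: funext => y; rewrite /midpoint; lra.
move=> /(congr1 (@^~ x)) /= h.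
by move: vx0; rewrite (_ : v x = 0) ?eqxx//; nra.
Qed.

(** The norm of a positive functional is the limit of its values on the units:
    if [v x] nearly attains the norm, then so does [v (e x)], and
    [v (e x) ^+ 2 <= v (e e) * v (x^* x)]. *)
Lemma norm1_units v (eps : R) : has_units inB -> pos_functional v -> contractive v ->
  (forall s, (forall y, `|v y| <= s * nrm y) -> 1 <= s) -> 0 < eps -> eps <= 1 ->
  exists x, exists2 delta, 0 < delta & forall e, star e = e -> nrm (x - e ** x) < delta ->
    1 - 2 * eps <= v (e ** e).
Proof.
move=> uB pv cv v1 e0 e1.
have [x vx] : exists x, (1 - eps) * nrm x < `|v x|.
  apply: contrapT => nx; suff : 1 <= 1 - eps by lra.
  by apply: v1 => y; rewrite leNgt; apply/negP => ?; apply: nx; exists y.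
have vx0 : 0 < nrm x.
  rewrite lt_neqAle nrm_ge0 andbT; apply/eqP => n0; have := cv x.
  by move: vx; rewrite -n0 mulr0 => /lt_le_trans /[apply]; rewrite ltxx.
exists x, (`|v x| - (1 - eps) * nrm x); first by rewrite subr_gt0.
move=> e se xe; have vex : (1 - eps) * nrm x <= `|v (e ** x)|.
  have := cv (x - e ** x); rewrite (posB pv).
  have := ler_normD (v x - v (e ** x)) (v (e ** x)); rewrite subrK; lra.
have := pos_cauchy_schwarz pv e x; rewrite se -real_normK ?num_real// => cs.
have ee0 : 0 <= v (e ** e) by rewrite -{1}se pos_ge0.
have xx : v (star x ** x) <= nrm x ^+ 2.
  by rewrite -nrm_starM; apply: le_trans (cv _); exact: ler_norm.
have : ((1 - eps) * nrm x) ^+ 2 <= v (e ** e) * nrm x ^+ 2.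
  apply: le_trans (ler_wpM2l ee0 xx); apply: le_trans cs.
  by rewrite lerXn2r ?nnegrE// mulr_ge0 ?nrm_ge0// subr_ge0.
rewrite exprMn ler_pM2r ?exprn_gt0//; have := sqr_ge0 eps; nra.
Qed.

End CentralFunctionals.

(** * Extreme central functionals are multiplicative *)

Section ExtremeCentral.
Variables (R : realType) (A : cStarAlgType R) (B : cStarSubalg A).
Implicit Types (x y : A) (u v w : A -> R).
Local Notation inB := (subalg_set B).
Hypotheses (abB : abelian_subalg B) (uB : has_units inB).

Section Central.
Variable v : A -> R.
Hypotheses (pv : pos_functional v) (cv : contractive v) (zv : central B v).

(** By centrality, multiplication on the right by [c] and by [star c] are adjoint
    for the form of [v]; so the argument of [pos_mulr] applies on the right. *)
Lemma central_mulr c x : inB c -> nrm c <= 1 ->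
  v (star (x ** c) ** (x ** c)) <= v (star x ** x).
Proof.
pose q y := v (star y ** y).
have q0 y : 0 <= q y by exact: pos_ge0.
have sa h : inB h -> nrm h <= 1 -> star h = h -> q (x ** h) <= q x.
  move=> Bh h1 sh.
  apply: (@contraction_of_bounded_orbit _ _ q (fun y => y ** h) _ (nrm x ^+ 2)) => //.
  - move=> y; rewrite {1}/q [v (star (y ** h) ** _)](_ : _ = v (star y ** (y ** h ** h))).
      exact: pos_cauchy_schwarz.
    by rewrite starM sh -cmulA zv// -!cmulA.
  - move=> j; have : nrm (iter j (fun y => y ** h) x) <= nrm x.
      elim: j => //= j IH; apply: le_trans (nrmM _ _) _.
      by rewrite -[leRHS]mulr1 ler_pM ?nrm_ge0.
    move=> hj; apply: le_trans (ler_norm _) (le_trans (cv _) _).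
    by rewrite nrm_starM lerXn2r ?nnegrE ?nrm_ge0.
move=> Bc c1; rewrite -/(q (x ** c)) -/(q x).
have Bc' : inB (star c) by exact: subalg_star.
have cc1 : nrm (c ** star c) <= 1.
  by rewrite -{1}[c]starK nrm_starM nrm_star expr_le1 ?nrm_ge0.
have := sa _ (subalgM Bc Bc') cc1; rewrite starM starK => /(_ erefl) h.
have cs : q (x ** c) ^+ 2 <= q x * q (x ** (c ** star c)).
  rewrite {1}/q starM -cmulA zv// -2!cmulA; exact: pos_cauchy_schwarz.
have := q0 x; have := q0 (x ** c); have := q0 (x ** (c ** star c)); nra.
Qed.

Lemma central_sqr c y : inB c -> v (star c ** c ** y) = v (c ** y ** star c).
Proof. by move=> Bc; rewrite -cmulA zv//; exact: subalg_star. Qed.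

Lemma central_sqr_ge0 c x : inB c ->
  0 <= v (star c ** c ** (star x ** x)).
Proof.
move=> Bc; rewrite central_sqr// (_ : _ ** _ = star (x ** star c) ** (x ** star c)).
  exact: pos_ge0.
by rewrite starM starK !cmulA.
Qed.

Lemma central_sqr_le c x : inB c -> nrm c <= 1 ->
  v (star c ** c ** (star x ** x)) <= v (star x ** x).
Proof.
move=> Bc c1; rewrite central_sqr// (_ : _ ** _ = star (x ** star c) ** (x ** star c)).
  by apply: central_mulr; [exact: subalg_star|rewrite nrm_star].
by rewrite starM starK !cmulA.
Qed.

Lemma central_sqr_i c x : inB c ->
  v ('i *: (star c ** c ** (star x ** x))) = 0.
Proof.
move=> Bc; rewrite -cmulZr central_sqr// cmulZr cmulZl.
rewrite (_ : _ ** _ ** _ = star (x ** star c) ** (x ** star c)); first exact: pos_i.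
by rewrite starM starK !cmulA.
Qed.

End Central.

(** For [h = c^* c], the perturbations [w = v +- (v (h x) - v h * v x)] have
    [v] as their midpoint, and they are positive because
    [0 <= v (h x^* x) <= v (x^* x)]. They are contractive because the
    perturbation vanishes in the limit on the units, where [v] tends to one
    and [v (h e e)] to [v h]. *)
Lemma extreme_mul v a c x : extreme (central_functionals B) v -> v a != 0 ->
  inB c -> nrm c <= 1 ->
  v (star c ** c ** x) = v (star c ** c) * v x.
Proof.
move=> ev va Bc c1; have v1 := extreme_norm1 ev va.
have [[pv cv zv] ex] := ev.
set h := star c ** c; have Bh : inB h by apply: subalgM => //; exact: subalg_star.
have h1 : nrm h <= 1 by rewrite nrm_starM expr_le1 ?nrm_ge0.
have vh0 : 0 <= v h by exact: pos_ge0.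
have vh1 : v h <= 1 by apply: le_trans (ler_norm _) (le_trans (cv _) _).
have sqr0 y : 0 <= v (h ** (star y ** y)) by exact: central_sqr_ge0.
have sqr1 y : v (h ** (star y ** y)) <= v (star y ** y) by exact: central_sqr_le.
pose w (s : R) y := v y + s * (v (h ** y) - v h * v y).
have hs (s : R) : s ^+ 2 = 1 -> s = 1 \/ s = -1.
  by move/eqP; rewrite sqrf_eq1 => /orP[] /eqP; [left|right].
have pw s : s ^+ 2 = 1 -> pos_functional (w s).
  move=> s1; split; rewrite /w.
  - by move=> y z; rewrite cmulDr !(posD pv); lra.
  - by move=> r y; rewrite cmulZr !(posZ pv); lra.
  - move=> y; have := sqr0 y; have := sqr1 y; have := pos_ge0 pv y.
    by case: (hs s s1) => ->; nra.
  - move=> y; rewrite cmulZr central_sqr_i// (pos_i pv); lra.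
  - exists (1 + `|s| * (1 + 1)) => y.
    have hy : `|v (h ** y)| <= nrm y.
      by apply: le_trans (cv _) (le_trans (nrmM _ _) _); rewrite ler_piMl ?nrm_ge0.
    have vhy : `|v h * v y| <= nrm y.
      by rewrite normrM ger0_norm// (le_trans _ (cv y))// ler_piMl.
    apply: le_trans (ler_normD _ _) _; rewrite mulrDl mul1r lerD//.
    rewrite normrM -mulrA ler_wpM2l// mulrDl mul1r.
    by apply: le_trans (ler_normB _ _) _; rewrite lerD.
have Kw s : s ^+ 2 = 1 -> central_functionals B (w s).
  move=> s1; split; first exact: pw.
    have [M _ wM] := pos_bound (pw s s1).
    apply: (contractive_of_sqr_le wM) => y; rewrite -subr_le0.
    apply: (@le0_of_le_eps _ _ (8 * w s (star y ** y))) => eps eps0.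
    pose eps' := Num.min eps 1.
    have e'0 : 0 < eps' by rewrite lt_min eps0/=.
    have e'1 : eps' <= 1 by rewrite ge_min lexx orbT.
    have e'e : eps' <= eps by rewrite ge_min lexx.
    clearbody eps'.
    have [x0 [d d0 Hd]] := norm1_units uB pv cv v1 e'0 e'1.
    have wyy := pos_ge0 (pw s s1) y.
    suff : w s y ^+ 2 <= (1 + 8 * eps') * w s (star y ** y) by nra.
    apply: (pos_kadison uB (pw s s1) (l := [:: x0; h]) (delta := Num.min d eps')).
      by rewrite lt_min d0.
    move=> e Be se e1 /= /and3P[]; rewrite !lt_min => /andP[xd _] /andP[_ he] _.
    have eeE : nrm (h - h ** (e ** e)) <= 2 * eps'.
      have -> : h - h ** (e ** e) = (h - e ** h) + (e ** (h - e ** h)).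
        rewrite cmulBr addrA subrK; congr (_ - _).
        by rewrite (abB Bh (subalgM Be Be)) cmulA.
      apply: le_trans (nrmD _ _) _; have := nrmM e (h - e ** h).
      have : nrm e * nrm (h - e ** h) <= nrm (h - e ** h) by rewrite ler_piMl ?nrm_ge0.
      lra.
    have vee := Hd e se xd.
    have vee1 : v (e ** e) <= 1.
      apply: le_trans (ler_norm _) (le_trans (cv _) _).
      by apply: le_trans (nrmM _ _) _; rewrite -[leRHS]mul1r ler_pM ?nrm_ge0.
    have := le_trans (cv _) eeE; rewrite (posB pv) ler_norml => /andP[].
    rewrite /w; move: (v (h ** _)) => t t1 t2.
    have k1 : v h * (1 - v (e ** e)) <= 2 * eps' by nra.
    have k0 : 0 <= v h * (1 - v (e ** e)) by nra.
    by case: (hs s s1) => ->; lra.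
  move=> b y Bb; rewrite /w zv//; congr (_ + _ * (_ - _)).
  by rewrite cmulA (abB Bh Bb) -cmulA zv// cmulA.
have [] := ex (w 1) (w (-1)).
- by apply: Kw; rewrite expr1n.
- by apply: Kw; rewrite sqrrN expr1n.
- by apply: funext => y; rewrite /midpoint /w; lra.
move=> /(congr1 (@^~ x)); rewrite /w /=; lra.
Qed.

(** The functional behind [v] is multiplicative on [B]; here is the instance
    [f (b^* b) = 0] when [f b = 0]. Applying [star0] to [b] and to ['i b] gives
    both [v (b b^* + b^* b^* ) = 0] and [v (b b^* - b^* b^* ) = 0]. *)
Lemma extreme_kernel v a b : extreme (central_functionals B) v -> v a != 0 ->
  inB b -> v b = 0 -> v ('i *: b) = 0 -> v (star b ** b) = 0.
Proof.
move=> ev va Bb vb vib; have [[pv cv zv] _] := ev.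
(* Scaling [c] into the unit ball. *)
have mulh c x : inB c -> v (star c ** c ** x) = v (star c ** c) * v x.
  move=> Bc; have [c0|c0] := eqVneq (nrm c) 0.
    have -> : c = 0 by apply/eqP; rewrite -normr_eq0 nrmE c0.
    by rewrite cmul0r cmul0l (pos0 pv) mul0r.
  have Bc' : inB ((nrm c)^-1%:C *: c) by exact: subalgZ.
  have := extreme_mul x ev va Bc'.
  rewrite nrmZr normfV ger0_norm ?nrm_ge0// mulVf// lexx => /(_ isT).
  rewrite starZr !cmulZl !cmulZr !cmulZl !(posZ pv) -!mulrA.
  by do 2 move/(mulfI (invr_neq0 c0)).
(* The sum [y + y^* ] is the limit of [e y + y^* e], a combination of the
   squares of [e + y], [e] and [y], for which multiplicativity is known. *)
have star0 y z : inB y -> v y = 0 -> v ((y + star y) ** z) = 0.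
  move=> By vy; apply/eqP; rewrite -normr_le0.
  have [M M0 vM] := pos_bound pv.
  apply: (@le0_of_le_eps _ _ (2 * nrm z + 2 * `|v z|)) => eps eps0.
  have [e [Be se e1 /= /andP[ye _]]] := uB [:: y] eps0.
  pose r := e ** y + star y ** e.
  have rE : r = star (e + y) ** (e + y) - star e ** e - star y ** y.
    rewrite starD cmulDl !cmulDr se /r.
    by rewrite [RHS]addrAC addrA addrK -(addrA (e ** e)) [RHS]addrAC subrr add0r.
  have vr : v (r ** z) = v r * v z.
    by rewrite rE !cmulBl !(posB pv) !mulh//; [ring|exact: subalgD].
  have nr : nrm (y + star y - r) <= 2 * eps.
    have -> : y + star y - r = (y - e ** y) + star (y - e ** y).
      by rewrite starB starM se /r opprD addrACA.
    by apply: le_trans (nrmD _ _) _; rewrite nrm_star; lra.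
  have v0 : v (y + star y) = 0 by rewrite (posD pv) (pos_star uB pv) vy addr0.
  have h1 := cv (y + star y - r); rewrite (posB pv) v0 sub0r normrN in h1.
  have h2 : `|v ((y + star y) ** z) - v r * v z| <= nrm (y + star y - r) * nrm z.
    by rewrite -vr -(posB pv) -cmulBl; apply: le_trans (cv _) (nrmM _ _).
  have h4 := ler_normD (v ((y + star y) ** z) - v r * v z) (v r * v z).
  rewrite subrK normrM in h4.
  have : `|v r| * `|v z| <= 2 * eps * `|v z|.
    by rewrite ler_wpM2r//; apply: le_trans nr.
  have : nrm (y + star y - r) * nrm z <= 2 * eps * nrm z by rewrite ler_wpM2r ?nrm_ge0.
  lra.
have e1 := star0 b (star b) Bb vb.
have e2 := star0 ('i *: b) ('i *: star b) (subalgZ _ Bb) vib.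
have Bb' : inB (star b) by exact: subalg_star.
move: e1 e2; rewrite starZi !cmulDl cmulNl !cmulZr !cmulZl !scaleii opprK.
by rewrite (abB Bb Bb') !(posD pv) (posN pv); lra.
Qed.

End ExtremeCentral.

(** * Pure states and the extension property *)

Section DominatedStates.
Variables (R : realType) (D : cStarAlgType R).
Implicit Types (f g : D -> R[i]) (b : D).
Hypothesis uD : has_units [set: D].

(** Applied to [b] and to ['i b], the inequality [u b ^+ 2 <= u (b^* b)] kills
    both the real and the imaginary part. *)
Lemma state_sqr_eq0 f b : is_state f -> Re (f (star b ** b)) = 0 -> f b = 0.
Proof.
move=> sf fbb; have pf := Re_state_pos sf; have cf := Re_state_contractive sf.
have H c : Re (f (star c ** c)) = 0 -> Re (f c) = 0.
  move=> fc; apply/eqP; rewrite -sqrf_eq0 eq_le sqr_ge0 andbT -fc.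
  exact: (pos_sqr_le uD pf c cf).
have [lf _ _] := sf.
have im : Im (f b) = - Re (f ('i *: b)) by rewrite functionalZ// mulrC ReiNIm opprK.
have fib : Re (f ('i *: b)) = 0.
  by apply: H; rewrite starZi cmulNl cmulZr cmulZl scaleii opprK.
by apply/eqP; rewrite eq_complex im fib (H b fbb) oppr0 !eqxx.
Qed.

(** Inclusion of the kernels makes [g] a multiple of [f]; the factor is
    nonnegative, as seen on some [c^* c], and both norms are one. *)
Lemma state_eq_of_kernel f g : is_state f -> is_state g ->
  (forall b, f b = 0 -> g b = 0) -> g = f.
Proof.
move=> sf sg fg; have [lf f0 f1] := sf; have [lg g0 g1] := sg.
have [c fc] : exists c, f (star c ** c) != 0.
  apply: contrapT => nc; suff : fnorm f <= 0 by rewrite f1 ler10.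
  apply: fnorm_le => // x; rewrite mul0r state_sqr_eq0 ?normr0//.
  suff -> : f (star x ** x) = 0 by [].
  by apply/eqP/negPn/negP => fx; apply: nc; exists x.
pose l := g (star c ** c) / f (star c ** c).
have l0 : 0 <= l by rewrite divr_ge0.
have gE b : g b = l * f b.
  have := fg (f b *: (star c ** c) + (- f (star c ** c)) *: b).
  rewrite !functionalD// !functionalZ// !mulNr [f b * f _]mulrC subrr => /(_ erefl).
  move/subr0_eq => h; apply: (mulfI fc); rewrite -h /l [RHS]mulrA.
  by rewrite [f (star c ** c) * _]mulrC divfK// mulrC.
have lE : l = (Re l)%:C by rewrite RRe_real// ger0_real.
have rl0 : 0 <= Re l by rewrite -ler0c -lE.
have nl : Re `|l| = Re l by rewrite ger0_norm.
have l1 : 1 <= Re l.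
  rewrite -g1; apply: fnorm_le => // x.
  by rewrite gE Re_normM nl ler_wpM2l// state_le.
have l1' : 1 <= (Re l)^-1.
  rewrite -f1; apply: fnorm_le; rewrite ?invr_ge0// => x.
  have := state_le x sg; rewrite gE Re_normM nl => h.
  by rewrite mulrC ler_pdivlMr 1?mulrC//; lra.
have : Re l = 1.
  apply/le_anti; rewrite l1 andbT; move: l1'; rewrite invf_ge1//; lra.
by move=> rl; apply: funext => b; rewrite gE lE rl mul1r.
Qed.

End DominatedStates.

Section Extension.
Variables (R : realType) (A : cStarAlgType R) (B : cStarSubalg A).
Implicit Types (x y : A) (b c : subalg_type B) (u v : A -> R).
Local Notation inB := (subalg_set B).

Lemma nondegenerate_units : nondegenerate_inclusion B -> has_units inB.
Proof.
move=> [F [FF eP eF _] FB] s eps eps0.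
have H : \forall e \near F, all (fun x => nrm (x - e ** x) < eps) s.
  elim: s => [|x s IH]; first exact: nearW.
  have := eF x; move/cvgrPdist_lt => /(_ eps%:C); rewrite ltcR => /(_ eps0) xe.
  apply: filterS2 xe IH => e /= xe ->; rewrite andbT.
  by move: xe; rewrite nrmE ltcR.
have [e [[[[y eE] e1] Be] He]] := filter_ex (filterI (filterI eP FB) H).
by exists e; split => //; [rewrite eE starM starK|rewrite -nrm_le].
Qed.

Lemma subalg_units : has_units inB -> has_units [set: subalg_type B].
Proof.
move=> uB s eps eps0; have [e [Be se e1]] := uB (map (@Defs.incl R A B) s) eps eps0.
rewrite all_map => He; exists (mk_subalg Be); split => //.
exact: Defs.incl_inj.
Qed.

Lemma state_restrict f : has_units inB -> is_state f ->
  is_state (subalg_restrict (B := B) f).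
Proof.
move=> uB sf; have [lf f0 f1] := sf.
have pf := Re_state_pos sf; have cf := Re_state_contractive sf.
have lr : scalar (subalg_restrict (B := B) f) by move=> k x y; exact: lf.
split=> //; first by move=> b; exact: f0.
have rle b : Re `|subalg_restrict f b| <= 1 * nrm b.
  by rewrite mul1r; exact: (state_le (Defs.incl b) sf).
have ub : has_ubound (unit_values (subalg_restrict (B := B) f)).
  by exists 1 => _ [b /= b1 <-]; apply: le_trans (rle b) _; rewrite mul1r -nrm_le.
set s := fnorm _; have s0 : 0 <= s by rewrite /s fnormE ub_le_sup//; exact: unit_values0.
apply/le_anti; rewrite fnorm_le//=.
(* A bound s on B gives the bound sqrt s on A through the units of B. *)
suff : 1 <= Num.sqrt s.
  by rewrite -[X in X <= _]sqrtr1 ler_sqrt.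
rewrite -f1; apply: fnorm_le => //; last exact: sqrtr_ge0.
move=> y; apply: scalar_le => // x.
rewrite -sqrtr_sqr -[nrm x]ger0_norm ?nrm_ge0// -sqrtr_sqr -sqrtrM// ler_wsqrtr//.
have h : Re (f x) ^+ 2 <= s * Re (f (star x ** x)).
  apply: (pos_kadison (l := [::]) (delta := 1) uB pf) => // e Be _ e1 _.
  apply: le_trans (ler_norm _) (le_trans (Re_le_norm _) _).
  have := fnorm_bound (mk_subalg (subalgM Be Be)) lr ub.
  rewrite -/s => /le_trans; apply; rewrite -[leRHS]mulr1 ler_wpM2l//.
  by apply: le_trans (nrmM e e) _; rewrite -[leRHS]mul1r ler_pM ?nrm_ge0.
apply: le_trans h _; rewrite ler_wpM2l// -nrm_starM.
by apply: le_trans (ler_norm _) (cf _).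
Qed.

Lemma state_comp_expectation (E : A -> subalg_type B) (phi : subalg_type B -> R[i]) :
  conditional_expectation E -> is_state phi -> is_state (phi \o E).
Proof.
move=> [lE pE nE EB _] [lp p0 p1]; split.
- by move=> k x y /=; rewrite lE lp.
- move=> x /=; have [|b ->] := pE (star x ** x); first by exists x.
  exact: p0.
- rewrite -p1; congr sup; apply/seteqP; split=> _ [x /= x1 <-].
    by exists (E x) => //=; exact: le_trans (nE x) x1.
  by exists (Defs.incl x) => //=; rewrite EB.
Qed.

(** If [f = t g + (1 - t) h] on [B] and [f b = 0], then [f (b^* b) = 0] by
    [extreme_kernel]; as [g] and [h] are nonnegative there, both vanish at
    [b^* b], hence at [b]. *)
Lemma pure_of_extreme v a : abelian_subalg B -> has_units inB ->
  extreme (central_functionals B) v -> v a != 0 ->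
  pure_state (subalg_restrict (B := B) (complexify v)).
Proof.
move=> abB uB ev va; have [[pv cv zv] _] := ev.
have sv := complexify_state pv cv (extreme_norm1 ev va).
have sr := state_restrict uB sv; split => // g h t sg sh /andP[t0 t1] fE.
have uT := subalg_units uB.
set f := subalg_restrict _ in sr fE *.
have ker b : f b = 0 -> Re (g (star b ** b)) = 0 /\ Re (h (star b ** b)) = 0.
  move=> /eqP; rewrite eq_complex /= oppr_eq0 => /andP[/eqP vb /eqP vib].
  have vbb : v (Defs.incl (star b ** b)) = 0.
    by apply: (extreme_kernel abB uB ev va _ vb vib); exact: in_subalg.
  have : Re (f (star b ** b)) = 0 by [].
  rewrite fE /convex_comb Re_add !Re_realM.
  have := pos_ge0 (Re_state_pos sg) b; have := pos_ge0 (Re_state_pos sh) b.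
  rewrite /real_part; nra.
by split; apply: state_eq_of_kernel => // b fb;
  apply: state_sqr_eq0 => //; have [] := ker b fb.
Qed.

(** By the Krein-Milman argument it is enough to treat the extreme points of
    the central functionals; these restrict to pure states of [B], where [f] and
    [f \o E] are both extensions. *)
Lemma central_expectation (E : A -> subalg_type B) u x : abelian_subalg B -> has_units inB ->
  extension_property B -> conditional_expectation E ->
  central_functionals B u -> u x = u (Defs.incl (E x)).
Proof.
move=> abB uB ext cE Ku; have [pu _ _] := Ku; have [lE _ _ EB _] := cE.
have ge0 a : E a = 0 -> u a <= 0.
  move=> Ea; rewrite leNgt; apply/negP => ua.
  have [v ev maxv] := exists_extreme_max a (@central_compact R A B) Ku.
  have va : 0 < v a by apply: lt_le_trans (maxv u Ku).
  have [[pv cv zv] _] := ev; have va0 : v a != 0 by rewrite gt_eqF.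
  have sv := complexify_state pv cv (extreme_norm1 ev va0).
  have [f [_ funi]] := ext _ (pure_of_extreme abB uB ev va0).
  have /funi fv : is_state (complexify v) /\
    subalg_restrict (complexify v) = subalg_restrict (B := B) (complexify v) by [].
  have /funi fE : is_state (subalg_restrict (complexify v) \o E) /\
      subalg_restrict (subalg_restrict (complexify v) \o E) =
      subalg_restrict (B := B) (complexify v).
    split; first exact: state_comp_expectation (state_restrict uB sv).
    by apply: funext => b; rewrite /subalg_restrict /= EB.
  have := congr1 (fun g => Re (g a)) (etrans (esym fv) fE).
  by rewrite /= Ea /= (pos0 pv) => v0; rewrite v0 ltxx in va.
have E0 y : E (y - Defs.incl (E y)) = 0.
  by rewrite -scaleN1r addrC lE EB scaleN1r addNr.
have E00 : E 0 = 0 by have := lE (-1) 0 0; rewrite scaler0 addr0 scaleN1r addNr.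
have EN y : E (- y) = - E y.
  by rewrite -[- y]addr0 -scaleN1r lE E00 addr0 scaleN1r.
apply/le_anti/andP; split.
  by rewrite -subr_le0 -(posB pu) ge0.
by rewrite -subr_le0 -(posB pu) -opprB ge0// EN E0 oppr0.
Qed.

End Extension.

(** * Normalizers and traces *)

Section NormClosure.
Variables (R : realType) (A : cStarAlgType R).
Implicit Types (S : set A) (x y : A).

Lemma closure_nrm S x (eps : R) : closure S x -> 0 < eps ->
  exists2 y, S y & nrm (x - y) < eps.
Proof.
move=> Sx e0; have e1 : 0 < eps%:C by rewrite ltcR.
have [y [Sy xy]] := Sx _ (nbhsx_ballx x _ e1).
by exists y => //; move: xy; rewrite -ball_normE /= nrmE ltcR.
Qed.

Lemma closed_nrm S x : closed S ->
  (forall eps : R, 0 < eps -> exists2 y, S y & nrm (x - y) < eps) -> S x.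
Proof.
move=> cS h; apply: cS => U /nbhs_ballP[e /= e0 eU].
have eE : e = (Re e)%:C by rewrite RRe_real// ger0_real// ltW.
have e1 : 0 < Re e by rewrite -ltcR -eE.
have [y Sy xy] := h _ e1; exists y; split=> //; apply: eU.
by rewrite -ball_normE /= nrmE eE ltcR.
Qed.

End NormClosure.

Section Normalizers.
Variables (R : realType) (A : cStarAlgType R) (B : cStarSubalg A).
Implicit Types (n x y : A).
Local Notation inB := (subalg_set B).

Lemma normalizer_star n : normalizer B n -> normalizer B (star n).
Proof. by move=> nN b Bb; rewrite starK; have [] := nN b Bb. Qed.

Lemma normalizerZ (r : R) n : normalizer B n -> normalizer B (r%:C *: n).
Proof.
move=> nN b Bb; rewrite starZr !cmulZl !cmulZr.
by have [? ?] := nN b Bb; split; do 2 apply: subalgZ.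
Qed.

Lemma normalizerM n b : normalizer B n -> inB b -> normalizer B (n ** b).
Proof.
move=> nN Bb c Bc; have Bb' : inB (star b) by exact: subalg_star.
have [+ _] := nN _ (subalgM (subalgM Bb Bc) Bb').
have [_ +] := nN c Bc; rewrite starM => h1 h2; split; first by rewrite !cmulA in h2 *.
by have := subalgM (subalgM Bb' h1) Bb; rewrite !cmulA.
Qed.

(** [n^* n] is the limit of [n^* e n] along the units of [B]. *)
Lemma normalizer_sqr n : has_units inB -> normalizer B n -> inB (star n ** n).
Proof.
move=> uB nN; apply: (closed_nrm (@Defs.subalg_closed _ _ B)) => eps e0.
have n0 : 0 < nrm n + 1 by rewrite ltr_wpDl ?nrm_ge0.
have [e [Be se e1 /= /andP[ne _]]] := uB [:: n] _ (divr_gt0 e0 n0).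
exists (star n ** e ** n); first by have [] := nN e Be.
rewrite -cmulA -cmulBr; apply: le_lt_trans (nrmM _ _) _; rewrite nrm_star.
move: ne; rewrite ltr_pdivlMr// mulrC; apply: le_lt_trans.
by rewrite ler_wpM2r ?nrm_ge0// lerDl.
Qed.

End Normalizers.

Section InvariantTraces.
Variables (R : realType) (A : cStarAlgType R) (B : cStarSubalg A).
Implicit Types (x y z : A) (b c : subalg_type B).
Local Notation inB := (subalg_set B).
Hypotheses (abB : abelian_subalg B) (uB : has_units inB).

Section NormalizerCommutes.
Variables (u : A -> R) (n : A).
Hypotheses (pu : pos_functional u) (cu : contractive u) (zu : central B u).
Hypotheses (n1 : nrm n <= 1) (Bn : inB (star n ** n)).

Local Notation beta := (star n ** n).
Let D z := u (n ** z) - u (z ** n).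
Let T y := y - beta ** y.
Let T' y := y - n ** star n ** y.

(** Multiplication on the right by [beta] is moved to the left by centrality. *)
Lemma iter_swap k x w : u (x ** star (iter k T w)) = u (iter k T x ** star w).
Proof.
have sb : star beta = beta by rewrite starM starK.
elim: k x => // k IH x; rewrite iterS iterSr -IH /T starB (starM beta) sb.
by rewrite cmulBr cmulBl !(posB pu) cmulA -(cmulA beta) (zu _ Bn).
Qed.

(** Intertwining: [(1 - n^* n) n^* = n^* (1 - n n^* )]. *)
Lemma iter_star k w : iter k T (star n) ** w = star n ** iter k T' w.
Proof.
elim: k => // k IH; rewrite !iterS {1}/T {2}/T' cmulBl cmulBr -cmulA IH.
by rewrite !cmulA.
Qed.

(** The commutator [D] does not change under [T = 1 - beta], while both of its
    terms decay along the powers of [T]. *)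
Lemma commutator_vanishes (g : A -> A) :
  (forall y, g (T y) = T (g y)) -> (forall y, D (beta ** g y) = 0) ->
  forall y, D (g y) = 0.
Proof.
move=> gT gD y; set z := g y.
have Dk k : D (iter k T z) = D z.
  have -> : iter k T z = g (iter k T y).
    by elim: k => //= k IH; rewrite IH gT.
  elim: k => // k IH; rewrite iterS gT -IH /T.
  set a := g _; move: (gD (iter k T y)); rewrite -/a /D.
  by rewrite cmulBr cmulBl !(posB pu); lra.
apply/eqP; rewrite -sqrf_eq0 eq_le sqr_ge0 andbT.
pose M := 2 * (u (star z ** z) + u (star (star z) ** star z)).
apply: (@le0_of_natmul_le _ _ M) => k; rewrite -(Dk k) /D.
have h1 := pos_iter_sub z k pu n1.
have n1' : nrm (star n) <= 1 by rewrite nrm_star.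
have := pos_iter_sub (star z) k pu n1'; rewrite starK /= => h2.
rewrite -/T in h1; rewrite -/T' in h2.
have k1 := pos_sqr_le uB pu (n ** iter k T z) cu.
have k2 := pos_sqr_le uB pu (star n ** iter k T' (star z)) cu.
have e : u (iter k T z ** n) = u (star n ** iter k T' (star z)).
  by rewrite -(pos_star uB pu) starM iter_swap iter_star.
rewrite -e in k2; rewrite starK in h2.
have h1' := le_trans (ler_wpM2l (ler0n R k) k1) h1.
have h2' := le_trans (ler_wpM2l (ler0n R k) k2) h2.
rewrite /M starK; move: h1' h2'; set a := u (n ** _); set b := u (_ ** n) => h1' h2'.
have : k%:R * (a - b) ^+ 2 <= k%:R * (2 * (a ^+ 2 + b ^+ 2)).
  by rewrite ler_wpM2l//; have := sqr_ge0 (a + b); lra.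
lra.
Qed.

End NormalizerCommutes.

(** [n n^*] lies in [B] and the conjugates [n^* b n] do too, so that in
    [u (m^* b x m)] every factor from [B] can be moved around [x]. *)
Lemma conj_central u n : pos_functional u -> contractive u -> central B u ->
  nrm n <= 1 -> normalizer B n ->
  let m := n ** (star n ** n) in
  central_functionals B (fun x => u (star m ** x ** m)).
Proof.
move=> pu cu zu n1 nN m.
have Bn := normalizer_sqr uB nN.
have Bc : inB (n ** star n).
  by have := normalizer_sqr uB (normalizer_star nN); rewrite starK.
have m1 : nrm m <= 1.
  apply: le_trans (nrmM _ _) _; rewrite nrm_starM -exprS exprn_ile1 ?nrm_ge0//.
have le x : nrm (star m ** x ** m) <= nrm x.
  apply: le_trans (nrmM _ _) _; apply: le_trans (_ : nrm (star m ** x) * 1 <= _).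
    by rewrite ler_wpM2l ?nrm_ge0.
  rewrite mulr1; apply: le_trans (nrmM _ _) _; rewrite nrm_star.
  by rewrite ler_piMl ?nrm_ge0.
have sqr x : star m ** (star x ** x) ** m = star (x ** m) ** (x ** m).
  by rewrite starM !cmulA.
split; last 1 first.
- move=> b x Bb; have [_ Bnb] := nN b Bb.
  set c := n ** star n in Bc *.
  have mE : m = c ** n by rewrite /m /c !cmulA.
  have sm : star m = star n ** c by rewrite mE starM /c starM starK.
  have lhs : star m ** (b ** x) ** m = (star n ** b ** n) ** (star n ** x ** m).
    rewrite sm -(cmulA (star n)) (cmulA c) (abB Bc Bb) /c.
    by rewrite !cmulA.
  have rhs : star m ** (x ** b) ** m = (star n ** n) ** (star n ** x ** b ** m).
    by rewrite sm /c !cmulA.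
  rewrite lhs rhs (zu _ _ Bnb) (zu _ _ Bn).
  have -> : star n ** x ** m ** (star n ** b ** n) = star n ** x ** (c ** c ** b) ** n.
    by rewrite /m /c !cmulA.
  rewrite (abB (subalgM Bc Bc) Bb).
  by congr u; rewrite /m /c !cmulA.
- split.
  + by move=> x y; rewrite cmulDr cmulDl (posD pu).
  + by move=> r x; rewrite cmulZr cmulZl (posZ pu).
  + by move=> x; rewrite sqr pos_ge0.
  + by move=> x; rewrite cmulZr cmulZl sqr pos_i.
  + by exists 1 => x; rewrite mul1r; apply: le_trans (cu _) (le x).
- by move=> x; apply: le_trans (cu _) (le x).
Qed.

End InvariantTraces.

Section InvariantStates.
Variables (R : realType) (A : cStarAlgType R) (B : cStarSubalg A).
Variable E : A -> subalg_type B.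
Implicit Types (n x y z : A) (b c : subalg_type B).
Local Notation inB := (subalg_set B).
Local Notation incl := (@Defs.incl R A B).
Hypotheses (abB : abelian_subalg B) (uB : has_units inB).
Hypotheses (ext : extension_property B) (cE : conditional_expectation E).

Section State.
Variable phi : subalg_type B -> R[i].
Hypothesis sphi : is_state phi.
Local Notation u := (real_part (phi \o E)).

Lemma expectation_central : central_functionals B u.
Proof.
have sf := state_comp_expectation cE sphi.
split; [exact: Re_state_pos|exact: Re_state_contractive|move=> b x Bb].
have [_ _ _ _ bim] := cE; have [/= e1 e2] := bim (mk_subalg Bb) x.
rewrite /real_part /= e1 e2; congr (Re (phi _)).
by apply: Defs.incl_inj; apply: abB => //; exact: in_subalg.
Qed.

Lemma expectation_mul (b x : A) : inB b -> u (b ** incl (E x)) = u (b ** x).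
Proof.
move=> Bb; have [_ _ _ EB bim] := cE.
have [/= e1 _] := bim (mk_subalg Bb) x.
have [/= e2 _] := bim (mk_subalg Bb) (incl (E x)).
by rewrite /real_part /= e1 e2 EB.
Qed.

(** With [m = n beta], centrality of [u (m^* x m)] and invariance give
    [u (m^* x m) = u (m m^* x)]; at [x = m z] this is the vanishing of the
    commutator with [n] on [beta^4 z]. *)
Lemma invariant_normalizer n y : fully_invariant phi -> normalizer B n ->
  u (n ** y) = u (y ** n).
Proof.
move=> inv; wlog n1 : n / nrm n <= 1 => [wl nN|nN].
  have n0 : 0 < nrm n + 1 by rewrite ltr_wpDl ?nrm_ge0.
  have [pu _ _] := expectation_central.
  have := wl ((nrm n + 1)^-1%:C *: n) _ (normalizerZ _ nN).
  rewrite nrmZr ger0_norm ?invr_ge0 ?(ltW n0)// mulrC ler_pdivrMr// mul1r lerDl.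
  move=> /(_ ler01); rewrite cmulZl cmulZr !(posZ pu).
  by apply: mulfI; rewrite invr_eq0 gt_eqF.
have [pu cu zu] := expectation_central; have [_ _ _ EB _] := cE.
have Bn := normalizer_sqr uB nN.
pose beta := star n ** n; pose m := n ** beta.
have mN : normalizer B m by exact: normalizerM.
have Bm : inB (m ** star m).
  by have := normalizer_sqr uB (normalizer_star mN); rewrite starK.
have conj x : u (star m ** x ** m) = u (m ** star m ** x).
  have := central_expectation x abB uB ext cE (conj_central abB uB pu cu zu n1 nN).
  rewrite -/beta -/m => ->.
  have Bmx : inB (star m ** incl (E x) ** m).
    by have [_] := mN _ (in_subalg (E x)).
  have Bmm : inB (m ** star m ** incl (E x)) by exact: subalgM Bm (in_subalg _).
  rewrite -[RHS]expectation_mul//.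
  have := inv (star m) (E x) (mk_subalg Bmx) (mk_subalg Bmm) (normalizer_star mN).
  rewrite starK => /(_ erefl erefl) h.
  rewrite /real_part /= -[star m ** incl (E x) ** m]/(incl (mk_subalg Bmx)).
  by rewrite -[m ** star m ** incl (E x)]/(incl (mk_subalg Bmm)) !EB h.
have Dm z : u (n ** (beta ** (beta ** (beta ** (beta ** z))))) =
            u (beta ** (beta ** (beta ** (beta ** z))) ** n).
  have mm : star m ** m = beta ** beta ** beta.
    by rewrite /m starM /beta starM starK !cmulA.
  have := conj (m ** z).
  rewrite (_ : star m ** (m ** z) ** m = beta ** beta ** beta ** z ** n ** beta); last first.
    by rewrite cmulA mm /m !cmulA.
  rewrite -(zu _ _ Bn) (_ : m ** star m ** (m ** z) = n ** beta ** (beta ** beta ** beta ** z)).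
    by rewrite -/beta !cmulA => ->.
  by rewrite -mm /m !cmulA.
have van (g : A -> A) : (forall z, g (z - beta ** z) = g z - beta ** g z) ->
    (forall z, u (n ** (beta ** g z)) = u (beta ** g z ** n)) ->
    forall z, u (n ** g z) = u (g z ** n).
  move=> gT gD z; apply/eqP; rewrite -subr_eq0; apply/eqP.
  apply: (commutator_vanishes uB pu cu zu n1 Bn gT) => w.
  by rewrite gD subrr.
have bT k z : iter k (cmul beta) (z - beta ** z) =
    iter k (cmul beta) z - beta ** iter k (cmul beta) z.
  by elim: k => //= k ->; rewrite cmulBr.
(* The four factors [beta] are removed one after the other. *)
have D3 := van (iter 3 (cmul beta)) (bT 3) Dm.
have D2 := van (iter 2 (cmul beta)) (bT 2) D3.
have D1 := van (iter 1 (cmul beta)) (bT 1) D2.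
exact: (van id (fun=> erefl) D1 y).
Qed.
(** The elements commuting with all others under [u] form a C*-subalgebra, so
    by regularity it is enough to test normalizers. *)
Lemma invariant_tracial : regular_inclusion B -> fully_invariant phi ->
  tracial_states A (phi \o E).
Proof.
move=> reg inv; have sf := state_comp_expectation cE sphi.
have [pu cu _] := expectation_central.
pose S : set A := [set x | forall y, u (x ** y) = u (y ** x)].
have SC : closed S.
  move=> x Sx y; apply/eqP; rewrite -subr_eq0 -normr_le0.
  apply: (@le0_of_le_eps _ _ (2 * nrm y)) => eps e0.
  have [z Sz xz] := closure_nrm Sx e0.
  have h1 := le_trans (cu _) (nrmM (x - z) y).
  have h2 := le_trans (cu _) (nrmM y (x - z)).
  rewrite cmulBl (posB pu) in h1; rewrite cmulBr (posB pu) -(Sz y) in h2.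
  have -> : u (x ** y) - u (y ** x) =
    (u (x ** y) - u (z ** y)) - (u (y ** x) - u (z ** y)) by lra.
  have : nrm (x - z) * nrm y <= eps * nrm y by rewrite ler_wpM2r ?nrm_ge0// ltW.
  have := ler_normB (u (x ** y) - u (z ** y)) (u (y ** x) - u (z ** y)).
  by rewrite [nrm y * nrm _]mulrC in h2; lra.
have S0 : S 0 by move=> y; rewrite cmul0l cmul0r.
have SD x y : S x -> S y -> S (x + y).
  by move=> Sx Sy z; rewrite cmulDl cmulDr !(posD pu) Sx Sy.
have SZ k x : S x -> S (k *: x).
  by move=> Sx z; rewrite cmulZl -cmulZr Sx cmulZl cmulZr.
have SM x y : S x -> S y -> S (x ** y).
  by move=> Sx Sy z; rewrite -cmulA Sx -cmulA Sy cmulA.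
have SS x : S x -> S (star x).
  move=> Sx z; rewrite -(pos_star uB pu) starM starK -Sx.
  by rewrite -(pos_star uB pu) starM starK.
have ST := reg (CStarSubalg SC S0 SD SZ SM SS) _.
have {ST} ST x : S x.
  suff -> : S = setT by [].
  by apply: ST => n nN y; exact: invariant_normalizer.
split => // x y; have [lf _ _] := sf.
apply/eqP; rewrite eq_complex; apply/andP; split; apply/eqP; first exact: ST.
have := ST ('i *: x) y; rewrite cmulZl cmulZr /real_part !functionalZ//.
by rewrite ![_ * (phi \o E) _]mulrC !ReiNIm => /oppr_inj.
Qed.

End State.

(** A trace is central for every subalgebra. *)
Lemma tracial_expectation tau : tracial_states A tau ->
  subalg_restrict (B := B) tau \o E = tau.
Proof.
move=> [st tr]; have sr := state_comp_expectation cE (state_restrict uB st).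
apply: eq_scalar_Re; [by have [] := sr|by have [] := st|].
apply: funext => x; rewrite [RHS](@central_expectation _ _ _ E)//.
split; [exact: Re_state_pos|exact: Re_state_contractive|].
by move=> b y _; rewrite /real_part tr.
Qed.

Lemma tracial_restrict tau : tracial_states A tau ->
  invariant_states B (subalg_restrict tau).
Proof.
move=> [st tr]; split; first exact: state_restrict.
by move=> n b c d _ hc hd; rewrite /subalg_restrict /= hc hd tr cmulA.
Qed.

End InvariantStates.

Lemma ptws_precomp_continuous (X Y : topologicalType) (U : uniformType)
    (h : Y -> X) :
  continuous (fun f : {ptws X -> U} => (f \o h : {ptws Y -> U})).
Proof.
move=> f; have Ff : Filter ((fun g : {ptws X -> U} => g \o h) @ nbhs f).
  exact: fmap_filter.
apply: (pointwise_cvgP _ _).2 => y.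
exact: (@proj_continuous X (fun=> U) (h y) f).
Qed.

Theorem corollary3p6 (R : realType) (A : cStarAlgType R) (B : cStarSubalg A)
    (E : A -> subalg_type B) :
  abelian_subalg B ->
  nondegenerate_inclusion B ->
  regular_inclusion B ->
  extension_property B ->
  conditional_expectation E ->
  affine_wstar_homeomorphism (invariant_states B) (tracial_states A)
    (fun phi : subalg_type B -> R[i] => phi \o E)
    (fun tau : A -> R[i] => subalg_restrict tau).
Proof.
move=> abB nd reg ext cE; have uB := nondegenerate_units nd.
have [_ _ _ EB _] := cE.
split; first by [].
split.
- by move=> phi [sphi inv]; exact: invariant_tracial.
- by move=> tau ttau; exact: tracial_restrict.
- by move=> phi _; apply: funext => b; rewrite /subalg_restrict /= EB.
- by move=> tau ttau; exact: tracial_expectation.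
split.
- exact/continuous_subspaceT/ptws_precomp_continuous.
- exact/continuous_subspaceT/ptws_precomp_continuous.
Qed.
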